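(* Let $\kappa=\pm\hbar$. The identity map of graded $\mathbb{C}[\hbar]$-modules $$\mathrm{Id}\colon \mathcal{F}^{\kappa}=\bigoplus_{k\ge 0}\mathbb{C}[\hbar][Y_1,\dots,Y_k]^{S_k}\longrightarrow \mathcal{S}^{\kappa}=\bigoplus_{k\ge 0}\mathbb{C}[\hbar][Y_1,\dots,Y_k]^{S_k}$$ is an algebra isomorphism from the shuffle-type algebra $\mathcal{F}^{\kappa}$ defined through degenerate affine Hecke algebras to the rational Feigin--Odesskii shuffle algebra $\mathcal{S}^{\kappa}$. In other words, the rational Feigin--Odesskii shuffle product coincides with the product induced from degenerate affine Hecke algebras.
   Context: $\hbar$ is a formal variable and $\kappa=\pm\hbar$. Degenerate affine Hecke algebra: $\mathfrak{H}^{\kappa}_k$ is the $\mathbb{C}[\hbar]$-algebra generated by $\sigma_1,\dots,\sigma_{k-1}$ and $Y_1,\dots,Y_k$ with relations $\sigma_i^2=1$, $\sigma_i\sigma_j=\sigma_j\sigma_i$ for $|i-j|>1$, $\sigma_i\sigma_{i+1}\sigma_i=\sigma_{i+1}\sigma_i\sigma_{i+1}$, $Y_iY_j=Y_jY_i$, $Y_{i+1}=\sigma_iY_i\sigma_i-\kappa\sigma_i$, and $\sigma_iY_j=Y_j\sigma_i$ for $j\ne i,i+1$. It contains $\mathbb{C}[S_k]$; let $e_k=\frac1{k!}\sum_{\sigma\in S_k}\sigma$ be the symmetrizer (denoted $e_k^\kappa$ when regarded in $\mathfrak{H}^\kappa_k$). Symmetric polynomials in the $Y_i$ are central in $\mathfrak{H}_k^\kappa$,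 and there is an isomorphism $\mathbb{C}[\hbar][Y_1,\dots,Y_k]^{S_k}\xrightarrow{\sim}e_k^\kappa\mathfrak{H}^{\kappa}_ke_k^\kappa$, $f\mapsto e_k^\kappa fe_k^\kappa$. The algebra $\mathcal{F}^\kappa$: as a module, $\mathcal{F}^\kappa=\bigoplus_{k\geq 0}\mathcal{F}^\kappa_k$ with $\mathcal{F}^\kappa_k=e^\kappa_k\mathfrak{H}^\kappa_ke^\kappa_k=\mathbb{C}[\hbar][Y_1,\dots,Y_k]^{S_k}$ (via the isomorphism above), with $\mathbb{C}[\hbar]$-linear product $\mathcal{F}^\kappa_k\otimes\mathcal{F}^\kappa_l\to\mathcal{F}^\kappa_{k+l}$, $$f*g=e^\kappa_{k+l}\,f(Y_1,\dots,Y_k)\,g(Y_{k+1},\dots,Y_{k+l})\,e^\kappa_{k+l}.$$ The rational Feigin--Odesskii shuffle algebra $\mathcal{S}^\kappa=\bigoplus_{k\geq 0}\mathcal{S}^\kappa_k$, $\mathcal{S}_k^\kappa=\mathbb{C}[\hbar][Y_1,\dots,Y_k]^{S_k}$, with $\mathbb{C}[\hbar]$-linear product $$(f*g)(Y_1,\dots,Y_{k+l})=\frac1{(k+l)!}\mathrm{Sym}_{k+l}\Bigl(\prod_{\substack{1\le i\le k\\ k+1\le j\le k+l}}\frac{Y_i-Y_j+\kappa}{Y_i-Y_j}\,f(Y_1,\dots,Y_k)\,g(Y_{k+1},\dots,Y_{k+l})\Bigr),$$ where $(\mathrm{Sym}_nF)(Y_1,\dots,Y_n)=\sum_{\sigma\in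 S_n}F(Y_{\sigma(1)},\dots,Y_{\sigma(n)})$. *)

(* Defs.v *)
From HB Require Import structures.
From mathcomp Require Import all_boot all_order all_fingroup all_algebra.
From mathcomp Require Import generic_quotient boolp classical_sets reals.
From mathcomp Require Import complex mpoly.

Set Implicit Arguments.
Unset Strict Implicit.
Unset Printing Implicit Defensive.

Import GRing.Theory.
Local Open Scope ring_scope.
Local Open Scope quotient_scope.

(* The ring of coefficients A is meant to be C[hbar], i.e. {poly R[i]} with
   hbar = 'X. The factors (n`!%:R)^-1 below are genuine inverses there, since
   n! is a nonzero constant; they are junk for a general A. *)

Section Presentation.
Variables (A : comNzRingType) (G : Type).

Inductive term : Type :=
| Scal of A
| Gen of G
| Add of term & term
| Mul of term & term.

(* The congruence generated by [rel] and the axioms of unital associative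
   A-algebras; the scalar a stands for a times the unit. *)
Inductive cong (rel : term -> term -> Prop) : term -> term -> Prop :=
| cong_rel s t : rel s t -> cong rel s t
| cong_refl t : cong rel t t
| cong_sym s t : cong rel s t -> cong rel t s
| cong_trans s t u : cong rel s t -> cong rel t u -> cong rel s u
| cong_Add s s' t t' :
    cong rel s s' -> cong rel t t' -> cong rel (Add s t) (Add s' t')
| cong_Mul s s' t t' :
    cong rel s s' -> cong rel t t' -> cong rel (Mul s t) (Mul s' t')
| cong_addA s t u : cong rel (Add s (Add t u)) (Add (Add s t) u)
| cong_addC s t : cong rel (Add s t) (Add t s)
| cong_add0 t : cong rel (Add (Scal 0) t) t
| cong_addN t : cong rel (Add (Mul (Scal (-1)) t) t) (Scal 0)
| cong_mulA s t u : cong rel (Mul s (Mul t u)) (Mul (Mul s t) u)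
| cong_mul1l t : cong rel (Mul (Scal 1) t) t
| cong_mul1r t : cong rel (Mul t (Scal 1)) t
| cong_mulDl s t u : cong rel (Mul (Add s t) u) (Add (Mul s u) (Mul t u))
| cong_mulDr s t u : cong rel (Mul s (Add t u)) (Add (Mul s t) (Mul s u))
| cong_ScalD a b : cong rel (Scal (a + b)) (Add (Scal a) (Scal b))
| cong_ScalM a b : cong rel (Scal (a * b)) (Mul (Scal a) (Scal b))
| cong_ScalC a t : cong rel (Mul (Scal a) t) (Mul t (Scal a)).

HB.instance Definition _ := gen_eqMixin term.
HB.instance Definition _ := gen_choiceMixin term.

Variable rel : term -> term -> Prop.

Definition congb (s t : term) : bool := `[< cong rel s t >].

Lemma congb_equiv : equiv_class_of congb.
Proof.
split=> [t|s t|t s u].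
- exact/asboolP/cong_refl.
- by apply/asboolP/asboolP => /cong_sym.
- by move=> /asboolP st /asboolP tu; apply/asboolP/(cong_trans st tu).
Qed.

Canonical congb_equiv_rel := EquivRelPack congb_equiv.
Canonical congb_encModRel := defaultEncModRel congb.

Definition presented := {eq_quot congb}.
HB.instance Definition _ : EqQuotient term congb presented :=
  EqQuotient.on presented.
HB.instance Definition _ := Choice.on presented.

Definition pi_pres (t : term) : presented := \pi_presented t.

Lemma pi_presP s t : pi_pres s = pi_pres t <-> cong rel s t.
Proof.
split; first by move=> /eqmodP /asboolP.
by move=> st; apply/eqmodP/asboolP.
Qed.

Lemma pi_pres_repr (x : presented) : pi_pres (repr x) = x.
Proof. exact: reprK. Qed.

Lemma cong_repr t : cong rel (repr (pi_pres t)) t.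
Proof. by apply/pi_presP; rewrite pi_pres_repr. Qed.

Definition pres_zero := pi_pres (Scal 0).
Definition pres_one := pi_pres (Scal 1).
Definition pres_add (x y : presented) := pi_pres (Add (repr x) (repr y)).
Definition pres_mul (x y : presented) := pi_pres (Mul (repr x) (repr y)).
Definition pres_scale (a : A) (x : presented) := pi_pres (Mul (Scal a) (repr x)).
Definition pres_opp (x : presented) := pres_scale (-1) x.

Lemma pi_pres_add s t : pres_add (pi_pres s) (pi_pres t) = pi_pres (Add s t).
Proof. by apply/pi_presP; apply: cong_Add; apply: cong_repr. Qed.

Lemma pi_pres_mul s t : pres_mul (pi_pres s) (pi_pres t) = pi_pres (Mul s t).
Proof. by apply/pi_presP; apply: cong_Mul; apply: cong_repr. Qed.

Lemma pi_pres_scale a t : pres_scale a (pi_pres t) = pi_pres (Mul (Scal a) t).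
Proof.
by apply/pi_presP; apply: cong_Mul; [apply: cong_refl | apply: cong_repr].
Qed.

Lemma pres_ind (P : presented -> Prop) : (forall t, P (pi_pres t)) ->
  forall x, P x.
Proof. by move=> h x; rewrite -[x]pi_pres_repr. Qed.

Lemma pres_addA : associative pres_add.
Proof.
elim/pres_ind=> s; elim/pres_ind=> t; elim/pres_ind=> u.
by rewrite !pi_pres_add; apply/pi_presP/cong_addA.
Qed.

Lemma pres_addC : commutative pres_add.
Proof.
elim/pres_ind=> s; elim/pres_ind=> t.
by rewrite !pi_pres_add; apply/pi_presP/cong_addC.
Qed.

Lemma pres_add0 : left_id pres_zero pres_add.
Proof.
by elim/pres_ind=> s; rewrite pi_pres_add; apply/pi_presP/cong_add0.
Qed.

Lemma pres_addN : left_inverse pres_zero pres_opp pres_add.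
Proof.
elim/pres_ind=> s; rewrite /pres_opp pi_pres_scale pi_pres_add.
exact/pi_presP/cong_addN.
Qed.

HB.instance Definition _ :=
  GRing.isZmodule.Build presented pres_addA pres_addC pres_add0 pres_addN.

Lemma pres_mulA : associative pres_mul.
Proof.
elim/pres_ind=> s; elim/pres_ind=> t; elim/pres_ind=> u.
by rewrite !pi_pres_mul; apply/pi_presP/cong_mulA.
Qed.

Lemma pres_mul1l : left_id pres_one pres_mul.
Proof.
by elim/pres_ind=> s; rewrite pi_pres_mul; apply/pi_presP/cong_mul1l.
Qed.

Lemma pres_mul1r : right_id pres_one pres_mul.
Proof.
by elim/pres_ind=> s; rewrite pi_pres_mul; apply/pi_presP/cong_mul1r.
Qed.

Lemma pres_mulDl : left_distributive pres_mul +%R.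
Proof.
elim/pres_ind=> s; elim/pres_ind=> t; elim/pres_ind=> u.
rewrite -[_ + _]/(pres_add _ _) -[RHS]/(pres_add _ _).
by rewrite pi_pres_add !pi_pres_mul pi_pres_add; apply/pi_presP/cong_mulDl.
Qed.

Lemma pres_mulDr : right_distributive pres_mul +%R.
Proof.
elim/pres_ind=> s; elim/pres_ind=> t; elim/pres_ind=> u.
rewrite -[_ + _]/(pres_add _ _) -[RHS]/(pres_add _ _).
by rewrite pi_pres_add !pi_pres_mul pi_pres_add; apply/pi_presP/cong_mulDr.
Qed.

HB.instance Definition _ := GRing.Zmodule_isPzRing.Build presented
  pres_mulA pres_mul1l pres_mul1r pres_mulDl pres_mulDr.

Lemma pres_scaleE a x : pres_scale a x = pi_pres (Scal a) * x.
Proof.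
by elim/pres_ind: x => t; rewrite pi_pres_scale -pi_pres_mul.
Qed.

Lemma pi_ScalD a b : pi_pres (Scal (a + b)) = pi_pres (Scal a) + pi_pres (Scal b).
Proof.
by rewrite -[RHS]/(pres_add _ _) pi_pres_add; apply/pi_presP/cong_ScalD.
Qed.

Lemma pi_ScalM a b : pi_pres (Scal (a * b)) = pi_pres (Scal a) * pi_pres (Scal b).
Proof.
by rewrite -[RHS]/(pres_mul _ _) pi_pres_mul; apply/pi_presP/cong_ScalM.
Qed.

Lemma pi_ScalC a x : pi_pres (Scal a) * x = x * pi_pres (Scal a).
Proof.
elim/pres_ind: x => t; rewrite -[LHS]/(pres_mul _ _) -[RHS]/(pres_mul _ _).
by rewrite !pi_pres_mul; apply/pi_presP/cong_ScalC.
Qed.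

Lemma pres_scaleA a b x : pres_scale a (pres_scale b x) = pres_scale (a * b) x.
Proof. by rewrite !pres_scaleE pi_ScalM mulrA. Qed.

Lemma pres_scale1 : left_id 1 pres_scale.
Proof. by move=> x; rewrite pres_scaleE mul1r. Qed.

Lemma pres_scaleDr : right_distributive pres_scale +%R.
Proof. by move=> a x y; rewrite !pres_scaleE mulrDr. Qed.

Lemma pres_scaleDl x : {morph pres_scale^~ x : a b / a + b}.
Proof. by move=> a b; rewrite !pres_scaleE pi_ScalD mulrDl. Qed.

HB.instance Definition _ := GRing.Zmodule_isLmodule.Build A presented
  pres_scaleA pres_scale1 pres_scaleDr pres_scaleDl.

Lemma pres_scalerAl a (x y : presented) : a *: (x * y) = a *: x * y.
Proof.
by rewrite -![_ *: _]/(pres_scale _ _) !pres_scaleE mulrA.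
Qed.

Lemma pres_scalerAr a (x y : presented) : a *: (x * y) = x * (a *: y).
Proof.
by rewrite -![_ *: _]/(pres_scale _ _) !pres_scaleE !mulrA pi_ScalC.
Qed.

End Presentation.

Section Adjacent.
Variable k : nat.

(* i : 'I_k.-1 indexes the i-th simple transposition, which exchanges
   ord_lo i = i and ord_hi i = i + 1 (indices are counted from 0). *)
Definition ord_lo (i : 'I_k.-1) : 'I_k := widen_ord (leq_pred k) i.

Lemma ord_hi_subproof (i : 'I_k.-1) : (i.+1 < k)%N.
Proof. by rewrite -ltn_predRL. Qed.

Definition ord_hi (i : 'I_k.-1) : 'I_k := Ordinal (ord_hi_subproof i).

Definition adjperm (i : 'I_k.-1) : 'S_k := tperm (ord_lo i) (ord_hi i).

Lemma tperm_word (x y : 'I_k) :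
  exists t : seq 'I_k.-1, (\prod_(i <- t) adjperm i)%g = tperm x y.
Proof.
wlog xy : x y / (x <= y)%N.
  move=> h; case: (leqP x y) => [/h//|/ltnW /h[t ht]].
  by exists t; rewrite tpermC.
move: xy; have [m] := ubnP (y - x); elim: m y => // m IHm y ltm.
rewrite leq_eqVlt => /orP[/eqP/val_inj->|ltxy].
  by exists [::]; rewrite big_nil tperm1.
have y_gt0 : (0 < y)%N by apply: leq_ltn_trans ltxy.
have lty : (y.-1 < k.-1)%N by rewrite ltn_predRL prednK.
pose i := Ordinal lty.
have hi_i : ord_hi i = y by apply/val_inj; rewrite /= prednK.
have [/eqP|nexy] := eqVneq (ord_lo i) x.
  by move/eqP=> lox; exists [:: i]; rewrite big_seq1 /adjperm lox hi_i.
have [||t ht] := IHm (ord_lo i).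
- by rewrite /= -subn1 subnAC subn1 -ltnS prednK ?subn_gt0.
- by rewrite /= -ltnS prednK.
exists ([:: i] ++ t ++ [:: i]); rewrite !big_cat !big_seq1 /= ht /adjperm hi_i.
rewrite -{1}[tperm (ord_lo i) y]tpermV mulgA -mulgA -/(conjg _ _) tpermJ tpermL tpermD //.
by apply/eqP => yx; move: ltxy; rewrite yx ltnn.
Qed.

Lemma perm_word_exists (w : 'S_k) :
  exists t : seq 'I_k.-1, (\prod_(i <- t) adjperm i)%g == w.
Proof.
have [ts -> _] := prod_tpermP w.
elim: ts => [|[x y] ts [t /eqP ht]]; first by exists [::]; rewrite !big_nil.
have [u hu] := tperm_word x y.
by exists (u ++ t); rewrite big_cat big_cons /= hu ht.
Qed.

Definition perm_word (w : 'S_k) : seq 'I_k.-1 := xchoose (perm_word_exists w).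

Lemma perm_wordP w : (\prod_(i <- perm_word w) adjperm i)%g = w.
Proof. exact/eqP/(xchooseP (perm_word_exists w)). Qed.

End Adjacent.

Section DAHA.
Variables (A : idomainType) (kappa : A) (k : nat).

Inductive daha_gen := GenSigma of 'I_k.-1 | GenY of 'I_k.

Local Notation "s '⋅' t" := (Mul s t) (at level 40, left associativity).
Local Notation "s '⊕' t" := (Add s t) (at level 50, left associativity).
Local Notation S i := (Gen A (GenSigma i)).
Local Notation Y i := (Gen A (GenY i)).

Inductive daha_rel : term A daha_gen -> term A daha_gen -> Prop :=
| rel_sigma2 i : daha_rel (S i ⋅ S i) (Scal _ 1)
| rel_sigmaC (i j : 'I_k.-1) : (i.+1 < j)%N || (j.+1 < i)%N ->
    daha_rel (S i ⋅ S j) (S j ⋅ S i)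
| rel_braid (i j : 'I_k.-1) : j = i.+1 :> nat ->
    daha_rel (S i ⋅ S j ⋅ S i) (S j ⋅ S i ⋅ S j)
| rel_YC i j : daha_rel (Y i ⋅ Y j) (Y j ⋅ Y i)
| rel_Y i :
    daha_rel (Y (ord_hi i)) (S i ⋅ Y (ord_lo i) ⋅ S i ⊕ Scal _ (- kappa) ⋅ S i)
| rel_sigmaY i j : j != ord_lo i -> j != ord_hi i ->
    daha_rel (S i ⋅ Y j) (Y j ⋅ S i).

Definition daha := presented daha_rel.

HB.instance Definition _ := Choice.on daha.
HB.instance Definition _ := GRing.PzRing.on daha.
HB.instance Definition _ := GRing.Lmodule.on daha.

(* The character sigma_i |-> 1, Y_j |-> - j * kappa, used to show that the
   algebra is nonzero. *)
Fixpoint daha_char (t : term A daha_gen) : A :=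
  match t with
  | Scal a => a
  | Gen (GenSigma _) => 1
  | Gen (GenY j) => - (kappa *+ j)
  | Add s t => daha_char s + daha_char t
  | Mul s t => daha_char s * daha_char t
  end.

Lemma daha_charP s t : cong daha_rel s t -> daha_char s = daha_char t.
Proof.
elim=> {s t} //=.
- move=> s t [] //= *; rewrite ?mulr1 ?mul1r //.
    exact: mulrC.
  by rewrite mulrSr opprD.
- by move=> s t u _ -> _ ->.
- by move=> s s' t t' _ -> _ ->.
- by move=> s s' t t' _ -> _ ->.
- by move=> *; rewrite addrA.
- by move=> *; rewrite addrC.
- by move=> *; rewrite add0r.
- by move=> *; rewrite mulN1r addNr.
- by move=> *; rewrite mulrA.
- by move=> *; rewrite mul1r.
- by move=> *; rewrite mulr1.
- by move=> *; rewrite mulrDl.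
- by move=> *; rewrite mulrDr.
- by move=> *; rewrite mulrC.
Qed.

Lemma daha_nonzero1 : (1 : daha) != 0.
Proof. by apply/eqP => /pi_presP /daha_charP /= /eqP; rewrite oner_eq0. Qed.

HB.instance Definition _ := GRing.PzSemiRing_isNonZero.Build daha daha_nonzero1.
HB.instance Definition _ :=
  GRing.Lmodule_isLalgebra.Build A daha (@pres_scalerAl _ _ _).
HB.instance Definition _ :=
  GRing.Lalgebra_isAlgebra.Build A daha (@pres_scalerAr _ _ _).

Definition dsigma (i : 'I_k.-1) : daha := pi_pres daha_rel (S i).
Definition dY (i : 'I_k) : daha := pi_pres daha_rel (Y i).

(* The element of the algebra given by w in the symmetric group: by the Coxeter
   relations it does not depend on the word in the simple transpositions that
   represents w. *)
Definition dperm (w : 'S_k) : daha := \prod_(i <- perm_word w) dsigma i.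

Definition symmetrizer : daha := (k`!%:R : A)^-1 *: \sum_(w : 'S_k) dperm w.

End DAHA.

(* f(y_0, ..., y_(m-1)) in an A-algebra. *)
Definition peval (A : comNzRingType) (B : algType A) (m : nat)
  (f : {mpoly A[m]}) (y : 'I_m -> B) : B := mmap (in_alg B) y f.

Section SymPoly.
Variables (A : comNzRingType) (n : nat).

Record sympoly := SymPoly {
  sympoly_val :> {mpoly A[n]};
  sympolyP : sympoly_val \is symmetric }.

HB.instance Definition _ := [isSub for sympoly_val].
HB.instance Definition _ := [Choice of sympoly by <:].
HB.instance Definition _ := [SubChoice_isSubLmodule of sympoly by <:].

Definition sympoly_one : sympoly := SymPoly (rpred1 _).

End SymPoly.

Section HeckeProduct.
Variables (A : idomainType) (kappa : A).

Local Notation e n := (symmetrizer kappa n).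

(* On symmetric polynomials, this is an isomorphism onto the spherical
   subalgebra e_n H_n e_n. *)
Definition spherical (n : nat) (f : {mpoly A[n]}) : daha kappa n :=
  e n * peval f (@dY A kappa n) * e n.

Definition hecke_elt (k l : nat) (f : sympoly A k) (g : sympoly A l) :
    daha kappa (k + l) :=
  e (k + l) * peval f (fun i => dY kappa (lshift l i))
            * peval g (fun j => dY kappa (rshift k j)) * e (k + l).

(* The preimage of [hecke_elt f g] under the isomorphism [spherical] (with
   default value 0 if there were none). *)
Definition hecke_mul (k l : nat) (f : sympoly A k) (g : sympoly A l) :
    sympoly A (k + l) :=
  xget 0 [set h : sympoly A (k + l) | spherical h = hecke_elt f g]%classic.

End HeckeProduct.

Section ShuffleProduct.
Variables (A : idomainType) (kappa : A).

Definition symmetrize (L : nmodType) (n : nat) (F : ('I_n -> L) -> L) (y : 'I_n -> L) : L :=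
  \sum_(s : 'S_n) F (fun i => y (s i)).

Local Notation ratfun n := {fraction {mpoly A[n]}}.
Local Notation cst n := (fun a : A => tofrac (a%:MP_[n])).

Definition shuffle_integrand (k l : nat) (f : {mpoly A[k]}) (g : {mpoly A[l]})
    (y : 'I_(k + l) -> ratfun (k + l)) : ratfun (k + l) :=
  (\prod_(i < k) \prod_(j < l)
     ((y (lshift l i) - y (rshift k j) + cst (k + l) kappa)
        / (y (lshift l i) - y (rshift k j))))
  * mmap (cst (k + l)) (fun i => y (lshift l i)) f
  * mmap (cst (k + l)) (fun j => y (rshift k j)) g.

Definition shuffle_elt (k l : nat) (f : sympoly A k) (g : sympoly A l) :
    ratfun (k + l) :=
  ((k + l)`!%:R)^-1 * symmetrize (shuffle_integrand f g) (fun i => tofrac 'X_i).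

(* The symmetric polynomial equal to the rational function [shuffle_elt f g]
   (with default value 0 if there were none). *)
Definition shuffle_mul (k l : nat) (f : sympoly A k) (g : sympoly A l) :
    sympoly A (k + l) :=
  xget 0 [set h : sympoly A (k + l) | tofrac (sympoly_val h) = shuffle_elt f g]%classic.

End ShuffleProduct.

Section DirectSum.
Variables (A : comNzRingType) (M : nat -> lmodType A).

Definition finsupp (x : forall n, M n) : Prop :=
  exists N, forall n, (N <= n)%N -> x n = 0.

Record dsum := DSum {
  dsum_val :> forall n, M n;
  dsumP : `[< finsupp dsum_val >] }.

HB.instance Definition _ := gen_eqMixin dsum.
HB.instance Definition _ := gen_choiceMixin dsum.

Lemma dsum_eq (x y : dsum) : (forall n, x n = y n) -> x = y.
Proof.
case: x y => [x hx] [y hy] /= xy.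
have exy : x = y by apply: functional_extensionality_dep.
by subst y; congr DSum; apply: bool_irrelevance.
Qed.

Lemma finsupp0 : `[< finsupp (fun n => 0) >].
Proof. by apply/asboolP; exists 0%N. Qed.

Lemma finsuppD (x y : dsum) : `[< finsupp (fun n => x n + y n) >].
Proof.
have /asboolP[N hN] := dsumP x; have /asboolP[N' hN'] := dsumP y.
apply/asboolP; exists (maxn N N') => n; rewrite geq_max => /andP[? ?].
by rewrite hN // hN' // addr0.
Qed.

Lemma finsuppZ a (x : dsum) : `[< finsupp (fun n => a *: x n) >].
Proof.
have /asboolP[N hN] := dsumP x; apply/asboolP; exists N => n /hN ->.
exact: scaler0.
Qed.

Definition dsum_zero := DSum finsupp0.
Definition dsum_add x y := DSum (finsuppD x y).
Definition dsum_scale a x := DSum (finsuppZ a x).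

Lemma dsum_addA : associative dsum_add.
Proof. by move=> x y z; apply: dsum_eq => n /=; rewrite addrA. Qed.
Lemma dsum_addC : commutative dsum_add.
Proof. by move=> x y; apply: dsum_eq => n /=; rewrite addrC. Qed.
Lemma dsum_add0 : left_id dsum_zero dsum_add.
Proof. by move=> x; apply: dsum_eq => n /=; rewrite add0r. Qed.
Lemma dsum_addN : left_inverse dsum_zero (dsum_scale (-1)) dsum_add.
Proof. by move=> x; apply: dsum_eq => n /=; rewrite scaleN1r addNr. Qed.

HB.instance Definition _ :=
  GRing.isZmodule.Build dsum dsum_addA dsum_addC dsum_add0 dsum_addN.

Lemma dsum_scaleA a b x : dsum_scale a (dsum_scale b x) = dsum_scale (a * b) x.
Proof. by apply: dsum_eq => n /=; rewrite scalerA. Qed.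
Lemma dsum_scale1 : left_id 1 dsum_scale.
Proof. by move=> x; apply: dsum_eq => n /=; rewrite scale1r. Qed.
Lemma dsum_scaleDr : right_distributive dsum_scale +%R.
Proof. by move=> a x y; apply: dsum_eq => n /=; rewrite scalerDr. Qed.
Lemma dsum_scaleDl x : {morph dsum_scale^~ x : a b / a + b}.
Proof. by move=> a b; apply: dsum_eq => n /=; rewrite scalerDl. Qed.

HB.instance Definition _ := GRing.Zmodule_isLmodule.Build A dsum
  dsum_scaleA dsum_scale1 dsum_scaleDr dsum_scaleDl.

Lemma finsupp_in n (u : M n) :
  `[< finsupp (dfwith (fun m => 0 : M m) u) >].
Proof.
apply/asboolP; exists n.+1 => m ltnm; rewrite dfwith_out //.
by rewrite ltn_eqF.
Qed.

Definition dsum_in n (u : M n) : dsum := DSum (finsupp_in u).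

Lemma dsum_bound_exists (x : dsum) :
  exists N, `[< forall n, (N <= n)%N -> x n = 0 >].
Proof. by have /asboolP[N hN] := dsumP x; exists N; apply/asboolP. Qed.

(* The least N such that the components of x of degree >= N vanish. *)
Definition dsum_size (x : dsum) : nat := ex_minn (dsum_bound_exists x).

End DirectSum.

(* Only the operations are bundled, with no law; the underlying module of the
   graded algebra X is [dsum X]. *)
Record galg (A : comNzRingType) := GAlg {
  gpiece :> nat -> lmodType A;
  gmul : forall k l, gpiece k -> gpiece l -> gpiece (k + l);
  gone : gpiece 0 }.

(* The product of the direct sum, extended from homogeneous components. *)
Definition dsum_mul (A : comNzRingType) (X : galg A) (x y : dsum X) : dsum X :=
  \sum_(k < dsum_size x) \sum_(l < dsum_size y) dsum_in (gmul (x k) (y l)).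

Definition dsum_one (A : comNzRingType) (X : galg A) : dsum X :=
  dsum_in (gone X).

Record graded_algebra_isomorphism (A : comNzRingType) (X Y : galg A)
    (phi : dsum X -> dsum Y) : Prop := GradedAlgebraIsomorphism {
  giso_linear : forall a x y, phi (a *: x + y) = a *: phi x + phi y;
  giso_bijective : bijective phi;
  giso_graded : forall n (u : X n), exists v : Y n, phi (dsum_in u) = dsum_in v;
  giso_one : phi (dsum_one X) = dsum_one Y;
  giso_mul : forall x y, phi (dsum_mul x y) = dsum_mul (phi x) (phi y) }.

Definition hecke_galg (A : idomainType) (kappa : A) : galg A :=
  GAlg (hecke_mul kappa) (sympoly_one A 0).

Definition shuffle_galg (A : idomainType) (kappa : A) : galg A :=
  GAlg (shuffle_mul kappa) (sympoly_one A 0).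

(* Main.v *)
Require Import Defs.
From mathcomp Require Import all_boot all_order all_fingroup all_algebra.
From mathcomp Require Import reals complex mpoly classical_sets fraction zify ring.

(* Let y be the point of coordinates Y_i over the field of fractions L. The
   algebra H_n acts on the functions F on the orbit S_n y: Y_j multiplies by the
   j-th coordinate, and with a_i = kappa / (y_i - y_(i+1)) the generator sigma_i
   sends F to s_i F + a_i (F - s_i F).
   Pushing the sigma_i to the right in H_n shows that e P(Y) e = Q(Y) e for some
   polynomial Q, and applying both sides to the constant function 1 shows that
   Q = e P in this module. So it suffices to compute e F.
   Put D = prod_(i < j) (y_i - y_j + kappa) / (y_i - y_j). The linear form
   F |-> sum_w w(D F) is invariant under the sigma_i, since
   s_i(D) (1 + a_i) = D (1 - a_i), hence it takes the same value at F and e F;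
   and e F is a constant function, since sigma_i fixes e F and 1 - a_i != 0. As
   sum_w w(D) = n!, this gives e F = (1 / n!) sum_w w(D F).
   Finally, for P = f(Y_1..Y_k) g(Y_(k+1)..Y_n), the average over S_k x S_l
   replaces the factors of D internal to the two blocks by 1, again because
   sum_w w(D) = n!, which leaves the shuffle kernel. *)

Set Implicit Arguments.
Unset Strict Implicit.
Unset Printing Implicit Defensive.

Import GRing.Theory.
Local Open Scope ring_scope.

(** * Words in a Coxeter family of type A *)

Section Coxeter.

(** The relations are stated for an arbitrary monoid law, so that one and the same rewriting of
    words serves in the symmetric group and in the Hecke algebra. *)
Definition coxeter (T : Type) (idx : T) (op : Monoid.law idx) (N : nat)
    (s : nat -> T) : Prop :=
  [/\ forall i, (i < N)%N -> op (s i) (s i) = idx,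
      forall i j, (i.+1 < j < N)%N -> op (s i) (s j) = op (s j) (s i)
    & forall i, (i.+1 < N)%N ->
        op (op (s i) (s i.+1)) (s i) = op (op (s i.+1) (s i)) (s i.+1)].

(** The word m-1, m-2, ..., j. For j from 0 to m these words give the m+1 minimal coset
    representatives of S_m in S_(m+1). *)
Definition downto (m j : nat) : seq nat := rev (iota j (m - j)).

Lemma downto_id m : downto m m = [::].
Proof. by rewrite /downto subnn. Qed.

Lemma downto_rcons m j : (j < m)%N -> downto m j = rcons (downto m j.+1) j.
Proof. by move=> lt_jm; rewrite /downto -(subnSK lt_jm) /= rev_cons. Qed.

Lemma downto_cons m j : (j <= m)%N -> downto m.+1 j = m :: downto m j.
Proof.
by move=> le_jm; rewrite /downto subSn // -addn1 iotaD rev_cat subnKC.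
Qed.

Lemma downto_cat m i j : (j <= i <= m)%N -> downto m j = downto m i ++ downto i j.
Proof.
case/andP=> le_ji le_im; rewrite /downto -rev_cat; congr rev.
have -> : (m - j = (i - j) + (m - i))%N.
  by rewrite addnC addnBA // subnK.
by rewrite iotaD subnKC.
Qed.

Lemma mem_downto m j i : (i \in downto m j) = (j <= i < m)%N.
Proof.
rewrite mem_rev mem_iota; case: (leqP j m) => [le_jm|lt_mj]; first by rewrite subnKC.
rewrite (eqP (ltnW lt_mj)) addn0; apply/andP/andP => -[le_ji].
  by rewrite ltnNge le_ji.
by move=> lt_im; have := leq_ltn_trans le_ji (ltn_trans lt_im lt_mj); rewrite ltnn.
Qed.

Section Law.
Variables (T : Type) (idx : T) (op : Monoid.law idx).

(* The [Monoid] lemmas, with [op] read through a single coercion path. *)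
Lemma opA x y z : op x (op y z) = op (op x y) z. Proof. exact: Monoid.mulmA. Qed.
Lemma op1m x : op idx x = x. Proof. exact: Monoid.mul1m. Qed.
Lemma opm1 x : op x idx = x. Proof. exact: Monoid.mulm1. Qed.

Lemma word_cat (I : Type) (s : I -> T) t u :
  \big[op/idx]_(x <- t ++ u) s x =
  op (\big[op/idx]_(x <- t) s x) (\big[op/idx]_(x <- u) s x).
Proof. exact: big_cat. Qed.

Lemma word_rcons (I : Type) (s : I -> T) t i :
  \big[op/idx]_(x <- rcons t i) s x = op (\big[op/idx]_(x <- t) s x) (s i).
Proof. by rewrite -cats1 word_cat big_seq1. Qed.

Variables (N : nat) (s : nat -> T).
Hypothesis cox : coxeter op N s.
Local Notation word t := (\big[op/idx]_(i <- t) s i).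

Lemma word_far i t : (i < N)%N ->
  (forall j, j \in t -> (j < N)%N && ((i.+1 < j) || (j.+1 < i))%N) ->
  op (word t) (s i) = op (s i) (word t).
Proof.
move=> lt_iN; have [_ comm _] := cox.
elim: t => [|j t IHt] far_t; first by rewrite big_nil op1m opm1.
rewrite !big_cons -opA IHt => [|j' t_j']; last first.
  by apply: far_t; rewrite inE t_j' orbT.
rewrite !opA; congr (op _ _).
have /andP[lt_jN] : (j < N)%N && ((i.+1 < j) || (j.+1 < i))%N.
  by apply: far_t; rewrite inE eqxx.
by case/orP=> far_j; [apply/esym|]; apply: comm; rewrite far_j.
Qed.

(** The letter i+1 commutes past the letters below i, the braid relation turns it into i, and i
    commutes past the letters above i+1. *)
Lemma downto_word_up m j i : (m <= N)%N -> (j <= i)%N -> (i.+1 < m)%N ->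
  op (word (downto m j)) (s i.+1) = op (s i) (word (downto m j)).
Proof.
move=> le_mN le_ji lt_im; have [_ _ braid] := cox.
have lt_iN : (i.+1 < N)%N by apply: leq_trans le_mN.
rewrite (@downto_cat m i.+2 j) ?lt_im ?andbT; last by apply: leqW; apply: leqW.
rewrite !downto_cons ?leqW // !word_cat !big_cons /=.
rewrite -!opA [op (word (downto i j)) _]word_far //; last first.
  move=> j'; rewrite mem_downto => /andP[_ lt_j'i].
  by rewrite ltnS lt_j'i orbT (ltn_trans lt_j'i) // ltnW.
set w := word (downto i j).
have braid_w : op (s i.+1) (op (s i) (op (s i.+1) w))
    = op (s i) (op (s i.+1) (op (s i) w)) by rewrite !opA braid.
rewrite braid_w !opA [op (word _) (s i)]word_far // => [|j']; first exact: ltnW.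
rewrite mem_downto => /andP[lt_ij' lt_j'm].
by rewrite lt_ij' (leq_trans lt_j'm).
Qed.

End Law.

(** The letter i leaves on the left unchanged if i+1 < j, extends the word if i+1 = j, cancels its
    last letter if i = j, and leaves as i-1 if i > j. This choice depends only on m, j and i, so [u]
    and [j'] are fixed before the monoid. *)
Lemma downto_letter m j i : (j <= m)%N -> (i < m)%N ->
  exists u j', [/\ all (ltn^~ m.-1) u, (j' <= m)%N &
    forall (T : Type) (idx : T) (op : Monoid.law idx) N s,
      coxeter op N s -> (m <= N)%N ->
    op (\big[op/idx]_(x <- downto m j) s x) (s i)
    = op (\big[op/idx]_(x <- u) s x) (\big[op/idx]_(x <- downto m j') s x)].
Proof.
move=> le_jm lt_im; have [lt_ij|lt_ji|eq_ij] := ltngtP i j.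
- have [lt_i1j|] := ltnP i.+1 j.
    exists [:: i], j; split=> //=.
      by rewrite andbT ltn_predRL (leq_trans lt_i1j).
    move=> T idx op N s cox le_mN; rewrite big_seq1 (word_far cox) //.
      exact: leq_trans le_mN.
    move=> x; rewrite mem_downto => /andP[le_jx lt_xm].
    by rewrite (leq_trans lt_xm) // (leq_trans lt_i1j).
  rewrite leq_eqVlt ltnNge lt_ij orbF => /eqP eq_ji.
  exists [::], i; split=> //; first exact: ltnW.
  move=> T idx op N s cox le_mN.
  by rewrite [downto m i]downto_rcons // -eq_ji word_rcons big_nil op1m.
- case: i lt_im lt_ji => // i lt_im lt_ji.
  exists [:: i], j; split=> //=; first by rewrite andbT ltn_predRL.
  by move=> T idx op N s cox le_mN; rewrite big_seq1 (downto_word_up cox).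
exists [::], j.+1; split=> //; first by rewrite -eq_ij.
move=> T idx op N s cox le_mN; have [sqr _ _] := cox.
rewrite eq_ij in lt_im *; rewrite downto_rcons // word_rcons big_nil op1m.
by rewrite -opA sqr ?opm1 // (leq_trans lt_im).
Qed.

Lemma word_normal_form m t : all (ltn^~ m) t ->
  exists u j, [/\ all (ltn^~ m.-1) u, (j <= m)%N &
    forall (T : Type) (idx : T) (op : Monoid.law idx) N s,
      coxeter op N s -> (m <= N)%N ->
    \big[op/idx]_(x <- t) s x
    = op (\big[op/idx]_(x <- u) s x) (\big[op/idx]_(x <- downto m j) s x)].
Proof.
elim/last_ind: t => [_|t i IHt].
  exists [::], m; split=> // T idx op N s _ _.
  by rewrite downto_id !big_nil opm1.
rewrite all_rcons => /andP[lt_im /IHt[u [j [lt_u le_jm eq_t]]]].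
have [v [j' [lt_v le_j'm eq_v]]] := downto_letter le_jm lt_im.
exists (u ++ v), j'; split=> //; first by rewrite all_cat lt_u.
move=> T idx op N s cox le_mN; rewrite word_rcons word_cat (eq_t _ _ _ _ _ cox le_mN).
by rewrite -opA (eq_v _ _ _ _ _ cox le_mN) opA.
Qed.

End Coxeter.

Lemma word_rev (I T : Type) (idx : T) (op : Monoid.law idx) (s : I -> T) v :
  (forall i, op (s i) (s i) = idx) ->
  op (\big[op/idx]_(i <- v) s i) (\big[op/idx]_(i <- rev v) s i) = idx.
Proof.
move=> s2; elim: v => [|i v IHv]; first by rewrite !big_nil opm1.
rewrite rev_cons word_rcons big_cons -!opA.
by rewrite [op (\big[op/idx]_(j <- v) _) _]opA IHv op1m s2.
Qed.

(** * Words in adjacent transpositions and the permutations they represent *)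

Section PermWords.
Variable n : nat.

(** Indexing by all naturals, with value [idx] out of range, lets letters be shifted without
    carrying bounds. *)
Definition letter (T : Type) (idx : T) (s : 'I_n.-1 -> T) (i : nat) : T :=
  if insub i is Some o then s o else idx.

Lemma letter_val T (idx : T) s (i : 'I_n.-1) : letter idx s i = s i.
Proof. by rewrite /letter valK. Qed.

Lemma coxeter_letter (T : Type) (idx : T) (op : Monoid.law idx)
    (s : 'I_n.-1 -> T) :
  (forall i, op (s i) (s i) = idx) ->
  (forall i j : 'I_n.-1, (i.+1 < j)%N -> op (s i) (s j) = op (s j) (s i)) ->
  (forall i j : 'I_n.-1, j = i.+1 :> nat ->
     op (op (s i) (s j)) (s i) = op (op (s j) (s i)) (s j)) ->
  coxeter op n.-1 (letter idx s).
Proof.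
move=> sqr comm braid; split=> [i lt_in|i j /andP[lt_ij lt_jn]|i lt_in].
- by rewrite -[ i ]/(val (Ordinal lt_in)) letter_val.
- have lt_in : (i < n.-1)%N by apply: leq_trans lt_jn; apply: leqW; apply: ltnW.
  rewrite -[ i ]/(val (Ordinal lt_in)) -[j]/(val (Ordinal lt_jn)) !letter_val.
  exact: comm.
have lt_in' : (i < n.-1)%N by apply: leq_trans lt_in.
rewrite -[i.+1]/(val (Ordinal lt_in)) -[ i ]/(val (Ordinal lt_in')) !letter_val.
exact: braid.
Qed.

Lemma coxeter_adjperm :
  coxeter (mulg : Monoid.law (1 : 'S_n)%g) n.-1 (letter 1%g (@adjperm n)).
Proof.
apply: coxeter_letter => [i|i j lt_ij|i j eq_ji]; first exact: tperm2.
  apply/commgP/conjg_fixP.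
  by rewrite /adjperm tpermJ !tpermD // -val_eqE /=; apply/eqP; lia.
have lo_j : ord_lo j = ord_hi i by apply: val_inj.
(* Each side of the braid relation is the conjugate of a transposition by an involution, and both
   are the transposition of the two outer points. *)
have lo_hi (a b : 'S_n) : (a * a = 1 -> a * b * a = b ^ a)%g.
  move=> aa; rewrite /conjg (_ : a^-1 = a)%g ?mulgA //.
  by apply: (mulgI a); rewrite mulgV aa.
apply: etrans (lo_hi _ _ (tperm2 _ _)) (etrans _ (esym (lo_hi _ _ (tperm2 _ _)))).
rewrite /adjperm !tpermJ lo_j tpermL tpermR.
by rewrite !tpermD // -val_eqE /=; apply/eqP; lia.
Qed.

Lemma adjperm_word_lt m t (x : 'I_n) : all (ltn^~ m) t -> (m < x)%N ->
  (\prod_(i <- t) letter 1 (@adjperm n) i)%g x = x.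
Proof.
move=> + lt_mx; elim: t => [|i t IHt] /=; first by rewrite big_nil perm1.
case/andP=> lt_im /IHt eq_t; rewrite big_cons permM /letter.
case: insubP => [o _ val_o|_]; last by rewrite perm1.
rewrite /adjperm tpermD // -val_eqE /= val_o ltn_eqF //; last exact: leq_ltn_trans lt_mx.
by apply: ltn_trans lt_mx.
Qed.

Lemma adjperm_downto m j (x : 'I_n) : (j <= m)%N -> x = m :> nat ->
  (\prod_(i <- downto m j) letter 1 (@adjperm n) i)%g x = j :> nat.
Proof.
elim: m x => [|m IHm] x.
  by rewrite leqn0 => /eqP-> x0; rewrite downto_id big_nil perm1.
rewrite leq_eqVlt => /predU1P[-> x_m|lt_jm x_m].
  by rewrite downto_id big_nil perm1.
have lt_mn : (m < n.-1)%N by rewrite ltn_predRL -x_m.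
rewrite downto_cons // big_cons permM (letter_val _ _ (Ordinal lt_mn)).
have -> : x = ord_hi (Ordinal lt_mn) by apply: val_inj.
by rewrite /adjperm tpermR IHm.
Qed.

(* The image of the point m under a word u ++ downto m j in normal form is j, so
   the normal form of a word for 1 has j = m. *)
Lemma coxeter_word1 (T : Type) (idx : T) (op : Monoid.law idx) s m t :
  coxeter op n.-1 s -> (m <= n.-1)%N -> all (ltn^~ m) t ->
  (\prod_(i <- t) letter 1 (@adjperm n) i = 1)%g ->
  \big[op/idx]_(i <- t) s i = idx.
Proof.
move=> cox; elim: m t => [|m IHm] t le_mn lt_t t1.
  by case: t lt_t {t1} => // _; rewrite big_nil.
have [u [j [lt_u le_jm eq_t]]] := word_normal_form lt_t.
move: t1; rewrite (eq_t _ _ _ _ _ coxeter_adjperm le_mn) (eq_t _ _ _ _ _ cox le_mn).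
have lt_mn : (m.+1 < n)%N by rewrite -ltn_predRL.
move=> uj1; have := congr1 (fun p : 'S_n => val (p (Ordinal lt_mn))) uj1.
rewrite /= permM perm1 (adjperm_word_lt lt_u) //= adjperm_downto //= => eq_jm.
move: uj1; rewrite eq_jm downto_id !big_nil /= mulg1 => u1.
by rewrite opm1 IHm // ltnW.
Qed.

(** As the letters are involutions, [rev u] inverts [u], which reduces the claim to the word
    [t ++ rev u] representing 1. This is what makes [dperm] multiplicative. *)
Lemma coxeter_word_eq (T : Type) (idx : T) (op : Monoid.law idx)
    (s : 'I_n.-1 -> T) (t u : seq 'I_n.-1) :
  coxeter op n.-1 (letter idx s) ->
  (\prod_(i <- t) adjperm i = \prod_(i <- u) adjperm i)%g ->
  \big[op/idx]_(i <- t) s i = \big[op/idx]_(i <- u) s i.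
Proof.
move=> cox eq_tu.
have map_val T' (idx' : T') (op' : Monoid.law idx') (s' : 'I_n.-1 -> T') v :
    \big[op'/idx']_(i <- v) s' i
    = \big[op'/idx']_(i <- map (@nat_of_ord n.-1) v) letter idx' s' i.
  by rewrite big_map; apply: eq_bigr => i _; rewrite letter_val.
have val_lt v : all (ltn^~ n.-1) (map (@nat_of_ord n.-1) v : seq nat).
  by apply/allP => _ /mapP[o _ ->] /=.
have [sqr _ _] := cox.
have s2 i : op (s i) (s i) = idx by rewrite -(letter_val idx) sqr.
have tu1 : op (\big[op/idx]_(i <- t) s i) (\big[op/idx]_(i <- rev u) s i) = idx.
  rewrite -word_cat map_val (coxeter_word1 cox (leqnn _)) //.
  rewrite -map_val big_cat /= eq_tu.
  exact: (word_rev (op := mulg) u (fun i => tperm2 _ _)).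
have := opA op (\big[op/idx]_(i <- t) s i) (\big[op/idx]_(i <- rev u) s i)
  (\big[op/idx]_(i <- rev (rev u)) s i).
by rewrite word_rev // opm1 tu1 op1m revK.
Qed.

End PermWords.

(** * Polynomials in the degenerate affine Hecke algebra *)

Section PolyEval.
Variables (A : comNzRingType) (n : nat).

(** Induction by one variable at a time matches the Hecke relations, which move a sigma past a
    single Y. *)
Lemma mpoly_indX (P : {mpoly A[n]} -> Prop) :
  (forall c, P c%:MP) -> (forall p q, P p -> P q -> P (p + q)) ->
  (forall i p, P p -> P ('X_i * p)) -> forall p, P p.
Proof.
move=> PC PD PX; elim/mpolyind=> [|c m p _ _ Pp]; first by rewrite -mpolyC0.
apply: PD => //; rewrite mpolyXE_id.
elim/big_rec: _ => [|i q _ Pq]; first by rewrite -mul_mpolyC mulr1.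
by elim: (m i) => [|d IHd]; rewrite ?expr0 ?mul1r // exprS -mulrA scalerAr; apply: PX.
Qed.

Section Commuting.
Variables (S : nzRingType) (phi : {rmorphism A -> S}) (h : 'I_n -> S).
Hypothesis comm_h : forall i j, GRing.comm (h i) (h j).
Hypothesis comm_phi : forall a x, GRing.comm (phi a) x.

(** The target ring is noncommutative, so multiplicativity of evaluation rests on the commuting
    values [h i] and the central scalars. *)
Lemma comm_mmapM p q : mmap phi h (p * q) = mmap phi h p * mmap phi h q.
Proof.
have mmap1D m1 m2 : mmap1 h (m1 + m2) = mmap1 h m1 * mmap1 h m2.
  rewrite /mmap1 -prodrM_comm => [|i j _ _]; last exact/commrX/commr_sym/commrX.
  by apply: eq_bigr => i _; rewrite mnmDE exprD.
elim/mpolyind: p => [|c m p _ _ IHp]; first by rewrite mul0r mmap0 mul0r.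
rewrite mulrDl !mmapD mulrDl IHp; congr (_ + _); clear IHp.
elim/mpolyind: q => [|d m' q _ _ IHq]; first by rewrite mulr0 mmap0 mulr0.
rewrite mulrDr !mmapD mulrDr IHq; congr (_ + _).
rewrite -scalerAl -scalerAr -mpolyXD !mmapZ !mmapX mmap1D !mulrA.
by rewrite -[in RHS](mulrA (phi c)) -[in RHS]comm_phi mulrA.
Qed.

End Commuting.
End PolyEval.

Lemma mmap_rename (A : comNzRingType) (m n : nat) (S : nzRingType)
    (phi : {rmorphism A -> S}) (h : 'I_n -> S) (r : 'I_m -> 'I_n) p :
  (forall i j, GRing.comm (h i) (h j)) -> (forall a x, GRing.comm (phi a) x) ->
  mmap phi h (mmap (@mpolyC n A) (fun i => 'X_(r i)) p)
  = mmap phi (fun i => h (r i)) p.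
Proof.
move=> comm_h comm_phi; elim/mpoly_indX: p => [c|p q IHp IHq|i p IHp].
- by rewrite !mmapC.
- by rewrite !mmapD IHp IHq.
rewrite rmorphM (comm_mmapM comm_h comm_phi) IHp.
rewrite (comm_mmapM (h := fun i => h (r i))) //.
by rewrite /= !mmapX !mmap1U mmapX !mmap1U.
Qed.

(** * Moving the sigma_i past polynomials in the Y_j *)

Section Hecke.
Variables (A : idomainType) (kappa : A) (k : nat).
Local Notation H := (daha kappa k).
Local Notation sigma := (@dsigma A kappa k).
Local Notation Y := (@dY A kappa k).
Local Notation pi := (pi_pres (daha_rel kappa (k := k))).

Lemma daha_piM s t : pi (Mul s t) = (pi s : H) * pi t.
Proof. by rewrite -pi_pres_mul. Qed.

Lemma daha_piD s t : pi (Add s t) = (pi s : H) + pi t.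
Proof. by rewrite -pi_pres_add. Qed.

Lemma daha_scal a x : pi (Scal _ a) * x = a *: x :> H.
Proof. by rewrite -[RHS]/(pres_scale _ _) pres_scaleE. Qed.

Lemma daha_eq s t : daha_rel kappa s t -> pi s = pi t.
Proof. by move=> st; apply/pi_presP/cong_rel. Qed.

Lemma dsigma_sqr i : sigma i * sigma i = 1.
Proof. by rewrite -daha_piM; apply: daha_eq; apply: rel_sigma2. Qed.

Lemma dsigma_comm (i j : 'I_k.-1) : (i.+1 < j)%N ->
  sigma i * sigma j = sigma j * sigma i.
Proof.
by move=> ij; rewrite -!daha_piM; apply/daha_eq/rel_sigmaC; rewrite ij.
Qed.

Lemma dsigma_braid (i j : 'I_k.-1) : j = i.+1 :> nat ->
  sigma i * sigma j * sigma i = sigma j * sigma i * sigma j.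
Proof. by move=> ij; have := daha_eq (rel_braid kappa ij); rewrite !daha_piM. Qed.

Lemma dY_comm i j : Y i * Y j = Y j * Y i.
Proof. by rewrite -!daha_piM; apply: daha_eq; apply: rel_YC. Qed.

Lemma dY_hi i : Y (ord_hi i) = sigma i * Y (ord_lo i) * sigma i - kappa *: sigma i.
Proof.
have -> : Y (ord_hi i) = pi (Gen A (GenY (ord_hi i))) by [].
by rewrite (daha_eq (rel_Y kappa i)) daha_piD !daha_piM daha_scal scaleNr.
Qed.

Lemma dsigma_Y i j : j != ord_lo i -> j != ord_hi i -> sigma i * Y j = Y j * sigma i.
Proof. by move=> lo hi; rewrite -!daha_piM; apply: daha_eq; apply: rel_sigmaY. Qed.

Lemma dsigma_Y_lo i : sigma i * Y (ord_lo i) = Y (ord_hi i) * sigma i + kappa *: 1.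
Proof.
by rewrite dY_hi mulrBl -!mulrA dsigma_sqr mulr1 -scalerAl dsigma_sqr subrK.
Qed.

Lemma dsigma_Y_hi i : sigma i * Y (ord_hi i) = Y (ord_lo i) * sigma i - kappa *: 1.
Proof.
by rewrite dY_hi mulrBr -scalerAr !mulrA dsigma_sqr mul1r.
Qed.

Lemma dsigma_coxeter :
  coxeter ( *%R : Monoid.law (1 : H)) k.-1 (letter 1 sigma).
Proof.
apply: coxeter_letter; [exact: dsigma_sqr|exact: dsigma_comm|exact: dsigma_braid].
Qed.

Lemma dperm_word (w : 'S_k) t : (\prod_(i <- t) adjperm i)%g = w ->
  dperm kappa w = \prod_(i <- t) sigma i.
Proof.
by move=> <-; apply: (coxeter_word_eq dsigma_coxeter); rewrite perm_wordP.
Qed.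

Lemma dpermM (v w : 'S_k) : dperm kappa (v * w)%g = dperm kappa v * dperm kappa w.
Proof.
by rewrite -big_cat; apply: dperm_word; rewrite big_cat /= !perm_wordP.
Qed.

Lemma dperm_adjperm i : dperm kappa (adjperm i) = sigma i.
Proof. by rewrite -(big_seq1 *%R i sigma); apply: dperm_word; rewrite big_seq1. Qed.

Local Notation e := (symmetrizer kappa k).

Lemma dsigma_symmetrizer i : sigma i * e = e.
Proof.
rewrite -scalerAr; congr (_ *: _); rewrite mulr_sumr.
rewrite [RHS](reindex_inj (mulgI (adjperm i))); apply: eq_bigr => w _.
by rewrite /= dpermM dperm_adjperm.
Qed.

Lemma pevalM p q : peval (p * q) Y = peval p Y * peval q Y.
Proof.
apply: comm_mmapM => [i j|a x]; first exact: dY_comm.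
by rewrite /GRing.comm mulr_algl mulr_algr.
Qed.

Lemma peval_rename m (r : 'I_m -> 'I_k) p :
  peval (mmap (@mpolyC k A) (fun i => 'X_(r i)) p) Y = peval p (fun i => Y (r i)).
Proof.
apply: mmap_rename => [i j|a x]; first exact: dY_comm.
by rewrite /GRing.comm mulr_algl mulr_algr.
Qed.

(** Passing one Y_j costs at most a term in which sigma_i has disappeared, with coefficient kappa or
    -kappa; a sigma_i that reaches [e] is absorbed by it. *)
Lemma dsigma_peval i p : exists q, sigma i * (peval p Y * e) = peval q Y * e.
Proof.
have pevalX j q : peval ('X_j * q) Y = Y j * peval q Y.
  by rewrite pevalM {1}/peval mmapX mmap1U.
have pevalD q r : peval (q + r) Y = peval q Y + peval r Y by exact: mmapD.
have pevalCM c q : peval (c%:MP * q) Y = c *: peval q Y.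
  by rewrite pevalM {1}/peval mmapC mulr_algl.
elim/mpoly_indX: p => [c|p q [p' IHp] [q' IHq]|j p [q IHp]].
- by exists c%:MP; rewrite /peval mmapC mulr_algl -scalerAr dsigma_symmetrizer.
- by exists (p' + q'); rewrite !pevalD !mulrDl mulrDr IHp IHq.
rewrite pevalX; have [->|neq_lo] := eqVneq j (ord_lo i).
  exists ('X_(ord_hi i) * q + kappa%:MP * p).
  rewrite !mulrA dsigma_Y_lo pevalD pevalX pevalCM !mulrDl -!mulrA IHp.
  by rewrite -!scalerAl mul1r.
have [->|neq_hi] := eqVneq j (ord_hi i).
  exists ('X_(ord_lo i) * q + (- kappa)%:MP * p).
  rewrite !mulrA dsigma_Y_hi pevalD pevalX pevalCM -scaleNr !mulrDl -!mulrA IHp.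
  by rewrite -!scalerAl mul1r.
by exists ('X_j * q); rewrite !mulrA dsigma_Y // -!mulrA IHp pevalX mulrA.
Qed.

Lemma symmetrizer_peval p : exists q, e * (peval p Y * e) = peval q Y * e.
Proof.
have sum_poly w : exists q, dperm kappa w * (peval p Y * e) = peval q Y * e.
  rewrite /dperm; elim: (perm_word w) => [|i t [q IHt]].
    by exists p; rewrite big_nil mul1r.
  have [q' eq_q'] := dsigma_peval i q.
  by exists q'; rewrite big_cons -mulrA IHt.
have [q eq_q] : exists q, (\sum_w dperm kappa w) * (peval p Y * e) = peval q Y * e.
  elim/big_rec: _ => [|w x _ [q IHx]].
    by exists 0; rewrite /peval mmap0 !mul0r.
  have [q' eq_q'] := sum_poly w; exists (q' + q).
  by rewrite /peval mmapD !mulrDl eq_q' IHx.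
exists ((k`!%:R)^-1 *: q).
by rewrite {1}/symmetrizer -scalerAl eq_q /peval mmapZ mulr_algl scalerAl.
Qed.

End Hecke.

(** * The principal series module *)

Lemma adjperm_lo k (i : 'I_k.-1) : adjperm i (ord_lo i) = ord_hi i.
Proof. exact: tpermL. Qed.

Lemma adjperm_hi k (i : 'I_k.-1) : adjperm i (ord_hi i) = ord_lo i.
Proof. exact: tpermR. Qed.

Lemma adjpermK k (i : 'I_k.-1) (w : 'S_k) : (adjperm i * (adjperm i * w) = w)%g.
Proof. by rewrite mulgA tperm2 mul1g. Qed.

Lemma adjperm_far k (i j : 'I_k.-1) (x : 'I_k) : x \in [:: ord_lo j; ord_hi j] ->
  (i.+1 < j)%N || (j.+1 < i)%N -> adjperm i x = x.
Proof.
move=> x_j far; rewrite /adjperm tpermD //; move: x_j far;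
  by rewrite !inE => /orP[]/eqP-> far; rewrite -val_eqE /=; apply/eqP; lia.
Qed.

Lemma adjperm_comm k (i j : 'I_k.-1) : (i.+1 < j)%N || (j.+1 < i)%N ->
  (adjperm i * adjperm j = adjperm j * adjperm i)%g.
Proof.
move=> far; apply/commgP/conjg_fixP; rewrite {1}/adjperm tpermJ.
by rewrite !(@adjperm_far _ _ i) // ?inE ?eqxx ?orbT // orbC.
Qed.

(* A function on the orbit of y under 'S_k is encoded by F : {ffun 'S_k -> L}, with
   F w its value at the point j |-> y (w j). *)
Section PrincipalSeries.
Variables (A : idomainType) (kappa : A) (k : nat).
Variables (L : fieldType) (iota : {rmorphism A -> L}) (y : 'I_k -> L).
Hypothesis y_inj : injective y.
Local Notation M := {ffun 'S_k -> L}.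
Implicit Types F G : M.
Local Notation H := (daha kappa k).
Local Notation sigma := (@dsigma A kappa k).
Local Notation Y := (@dY A kappa k).

(** Products of permutations compose from left to right, so [adjperm i * w] encodes the point of [w]
    with its coordinates i and i+1 exchanged. *)
Definition demazure (i : 'I_k.-1) (F : M) : M :=
  [ffun w => F (adjperm i * w)%g + iota kappa /
     (y (w (ord_lo i)) - y (w (ord_hi i))) * (F w - F (adjperm i * w)%g)].

Fixpoint term_act (t : term A (daha_gen k)) (F : M) : M :=
  match t with
  | Scal a => [ffun w => iota a * F w]
  | Gen (GenSigma i) => demazure i F
  | Gen (GenY j) => [ffun w : 'S_k => y (w j) * F w]
  | Add s t => term_act s F + term_act t F
  | Mul s t => term_act s (term_act t F)
  end.

(** Together with [term_actZ], this is what right distributivity and the centrality of scalars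
    demand of the action. *)
Lemma term_actD t F G : term_act t (F + G) = term_act t F + term_act t G.
Proof.
elim: t F G => [a|[i|j]|s IHs t IHt|s IHs t IHt] F G /=; last by rewrite IHt IHs.
- by apply/ffunP=> w; rewrite !ffunE mulrDr.
- by apply/ffunP=> w; rewrite !ffunE; ring.
- by apply/ffunP=> w; rewrite !ffunE mulrDr.
by rewrite IHs IHt addrACA.
Qed.

Lemma term_actZ t a F :
  term_act t [ffun w => iota a * F w] = [ffun w => iota a * term_act t F w].
Proof.
elim: t F => [b|[i|j]|s IHs t IHt|s IHs t IHt] F /=; last by rewrite IHt IHs.
- by apply/ffunP=> w; rewrite !ffunE mulrCA.
- by apply/ffunP=> w; rewrite !ffunE; ring.
- by apply/ffunP=> w; rewrite !ffunE mulrCA.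
by rewrite IHs IHt; apply/ffunP=> w; rewrite !ffunE mulrDr.
Qed.

Let diff_neq0 (w : 'S_k) i j : i != j -> y (w i) - y (w j) != 0.
Proof. by move=> neq_ij; rewrite subr_eq0 !inj_eq //; apply: perm_inj. Qed.

Lemma lo_neq_hi (i : 'I_k.-1) : ord_lo i != ord_hi i.
Proof. by rewrite -val_eqE /= ltn_eqF. Qed.

Lemma demazureK i F : demazure i (demazure i F) = F.
Proof.
apply/ffunP=> w; rewrite !ffunE /= adjpermK !permM adjperm_lo adjperm_hi.
have := diff_neq0 w (lo_neq_hi i); move: (y _) (y _) => b a ab.
have ba : b - a != 0 by rewrite -opprB oppr_eq0.
by field; rewrite ab ba.
Qed.

Lemma demazure_comm (i j : 'I_k.-1) F : (i.+1 < j)%N || (j.+1 < i)%N ->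
  demazure i (demazure j F) = demazure j (demazure i F).
Proof.
move=> far; apply/ffunP=> w; rewrite !ffunE /= !permM.
have far' : (j.+1 < i)%N || (i.+1 < j)%N by rewrite orbC.
rewrite ![adjperm i (_ j)](adjperm_far _ far) ?inE ?eqxx ?orbT //.
rewrite ![adjperm j (_ i)](adjperm_far _ far') ?inE ?eqxx ?orbT //.
by rewrite !mulgA (adjperm_comm far); ring.
Qed.

(** Only three coordinates occur. Both sides combine the values of F at their six rearrangements,
    and the coefficients agree as rational functions. *)
Lemma demazure_braid (i j : 'I_k.-1) F : j = i.+1 :> nat ->
  demazure i (demazure j (demazure i F)) = demazure j (demazure i (demazure j F)).
Proof.
move=> eq_ji; apply/ffunP=> w.
have lo_j : ord_lo j = ord_hi i by apply: val_inj.
have far_i : adjperm i (ord_hi j) = ord_hi j.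
  by rewrite /adjperm tpermD // -val_eqE /= ?eq_ji; apply/eqP; lia.
have far_j : adjperm j (ord_lo i) = ord_lo i.
  by rewrite /adjperm tpermD // -val_eqE /= ?eq_ji; apply/eqP; lia.
have adj_j : adjperm j (ord_hi i) = ord_hi j by rewrite -lo_j adjperm_lo.
(* The longest of the six rearrangements has two expressions; one is rewritten into the other so
   that the values of F match. *)
have braid v : (adjperm j * (adjperm i * (adjperm j * v))
    = adjperm i * (adjperm j * (adjperm i * v)))%g.
  have [_ _ br] := coxeter_adjperm k.
  have lt_ik : (i.+1 < k.-1)%N by rewrite -eq_ji.
  have := br i lt_ik; rewrite -eq_ji !letter_val !mulgA => br'.
  by congr (_ * _)%g; rewrite [RHS]br'.
rewrite !ffunE /= !lo_j !permM ?(adjperm_lo, adjperm_hi, far_i, far_j, adj_j, lo_j).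
rewrite !adjpermK !braid.
have neq_ab := diff_neq0 w (lo_neq_hi i).
have neq_bc := diff_neq0 w (lo_neq_hi j); rewrite lo_j in neq_bc.
have neq_ac : y (w (ord_lo i)) - y (w (ord_hi j)) != 0.
  by apply: diff_neq0; rewrite -val_eqE /= eq_ji; apply/eqP; lia.
move: (y _) (y _) (y _) neq_ab neq_bc neq_ac => c b a ab bc ac.
have ba : b - a != 0 by rewrite -opprB oppr_eq0.
have cb : c - b != 0 by rewrite -opprB oppr_eq0.
have ca : c - a != 0 by rewrite -opprB oppr_eq0.
by field; rewrite ?ab ?bc ?ac ?ba ?cb ?ca //.
Qed.

(** The correction is kappa times the divided difference of the j-th coordinate, which is 1, -1 or
    0. This covers both kinds of relations between sigma_i and Y_j. *)
Lemma demazure_Y i j F : let s := adjperm i in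
  demazure i [ffun w : 'S_k => y (w j) * F w]
  = [ffun w : 'S_k => y (w (s j)) * demazure i F w]
   + [ffun w => iota kappa * ((j == ord_lo i)%:R - (j == ord_hi i)%:R) * F w].
Proof.
apply/ffunP=> w; rewrite !ffunE /= permM.
have := diff_neq0 w (lo_neq_hi i).
have [->|neq_lo] := eqVneq j (ord_lo i).
  rewrite adjperm_lo (negbTE (lo_neq_hi i)); move: (y _) (y _) => b a ab.
  by rewrite mulr0n mulr1n; field; rewrite ab.
have [->|neq_hi] := eqVneq j (ord_hi i).
  rewrite adjperm_hi; move: (y _) (y _) => b a ab.
  by rewrite mulr0n mulr1n; field; rewrite ab.
by rewrite /adjperm tpermD 1?eq_sym // mulr0n => _; ring.
Qed.

Lemma term_act_rel s t F : daha_rel kappa s t -> term_act s F = term_act t F.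
Proof.
case=> [i|i j far|i j ij|i j|i|i j neq_lo neq_hi] /=.
- by rewrite demazureK; apply/ffunP=> w; rewrite ffunE rmorph1 mul1r.
- exact: demazure_comm.
- exact: demazure_braid.
- by apply/ffunP=> w; rewrite !ffunE mulrCA.
- rewrite demazure_Y adjperm_lo demazureK eqxx (negbTE (lo_neq_hi i)).
  by apply/ffunP=> w; rewrite !ffunE rmorphN mulr1n mulr0n; ring.
rewrite demazure_Y (negbTE neq_lo) (negbTE neq_hi) /adjperm tpermD 1?eq_sym //.
by apply/ffunP=> w; rewrite !ffunE mulr0n subrr mulr0 mul0r addr0.
Qed.

Lemma term_act_cong s t : cong (daha_rel kappa (k := k)) s t -> term_act s =1 term_act t.
Proof.
elim=> {s t} /=.
- by move=> s t st F; apply: term_act_rel.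
- by [].
- by move=> s t _ st F; rewrite st.
- by move=> s t u _ st _ tu F; rewrite st tu.
- by move=> s s' t t' _ ss' _ tt' F; rewrite ss' tt'.
- by move=> s s' t t' _ ss' _ tt' F; rewrite ss' tt'.
- by move=> s t u F; rewrite addrA.
- by move=> s t F; rewrite addrC.
- by move=> t F; apply/ffunP=> w; rewrite !ffunE rmorph0 mul0r add0r.
- by move=> t F; apply/ffunP=> w; rewrite !ffunE rmorphN rmorph1 rmorph0; ring.
- by [].
- by move=> t F; apply/ffunP=> w; rewrite !ffunE rmorph1 mul1r.
- by move=> t F; congr term_act; apply/ffunP=> w; rewrite !ffunE rmorph1 mul1r.
- by [].
- by move=> s t u F; rewrite term_actD.
- by move=> a b F; apply/ffunP=> w; rewrite !ffunE rmorphD mulrDl.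
- by move=> a b F; apply/ffunP=> w; rewrite !ffunE rmorphM mulrA.
- by move=> a t F; rewrite term_actZ.
Qed.

Definition daha_act (x : H) : M -> M := term_act (generic_quotient.repr x).

Lemma daha_act_pi t F : daha_act (pi_pres (daha_rel kappa (k := k)) t) F = term_act t F.
Proof. by apply: term_act_cong; apply: cong_repr. Qed.

Lemma daha_actM x z F : daha_act (x * z) F = daha_act x (daha_act z F).
Proof. exact: daha_act_pi. Qed.

Lemma daha_actD x z F : daha_act (x + z) F = daha_act x F + daha_act z F.
Proof. exact: daha_act_pi. Qed.

Lemma daha_actZ a x F : daha_act (a *: x) F = [ffun w => iota a * daha_act x F w].
Proof. by rewrite -[a *: x]/(pres_scale _ _) daha_act_pi. Qed.

Lemma daha_act1 F : daha_act 1 F = F.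
Proof. by rewrite daha_act_pi; apply/ffunP=> w; rewrite ffunE rmorph1 mul1r. Qed.

Lemma daha_act0 F : daha_act 0 F = 0.
Proof. by rewrite daha_act_pi; apply/ffunP=> w; rewrite !ffunE rmorph0 mul0r. Qed.

Lemma daha_act_sigma i F : daha_act (sigma i) F = demazure i F.
Proof. exact: daha_act_pi. Qed.

Lemma daha_act_peval p F :
  daha_act (peval p Y) F = [ffun w : 'S_k => mmap iota (fun i => y (w i)) p * F w].
Proof.
elim/mpoly_indX: p F => [c|p q IHp IHq|j p IHp] F.
- by rewrite /peval mmapC daha_actZ daha_act1; apply/ffunP=> w; rewrite !ffunE mmapC.
- rewrite /peval mmapD daha_actD -!/(peval _ _) IHp IHq.
  by apply/ffunP=> w; rewrite !ffunE mmapD mulrDl.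
rewrite pevalM daha_actM IHp {1}/peval mmapX mmap1U daha_act_pi.
by apply/ffunP=> w; rewrite !ffunE rmorphM /= mmapX mmap1U mulrA.
Qed.

Lemma daha_act_symmetrizer_cst F : (forall i j, y i - y j != iota kappa) ->
  exists c, daha_act (symmetrizer kappa k) F = [ffun=> c].
Proof.
move=> y_kappa; set G := daha_act _ F; exists (G 1%g).
have inv_G i w : G (adjperm i * w)%g = G w.
  have := congr1 (fun F' : M => F' w) (daha_act_sigma i G).
  rewrite -daha_actM dsigma_symmetrizer -/G ffunE => /eqP.
  have := diff_neq0 w (lo_neq_hi i).
  have : y (w (ord_lo i)) - y (w (ord_hi i)) - iota kappa != 0.
    by rewrite subr_eq0.
  move: (_ - y _) (iota kappa) => d c dc d0.
  rewrite -subr_eq0 => /eqP eq0; apply/eqP; rewrite -subr_eq0.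
  (* Up to sign, the fixed point equation is the difference of the two values times (d - c) / d, a
     nonzero factor. *)
  rewrite -(mulrI_eq0 _ (lregP (mulf_neq0 dc (invr_neq0 d0)))) -oppr_eq0.
  by rewrite -eq0; apply/eqP; field.
apply/ffunP=> w; rewrite ffunE -(perm_wordP w).
elim: (perm_word w) => [|i t IHt]; first by rewrite big_nil.
by rewrite big_cons inv_G.
Qed.

End PrincipalSeries.

(** * The weight D *)

Section PairProduct.
Variables (L : fieldType) (kap : L).

(** The weight D at the point [y], a rational analogue of the Hall-Littlewood kernel. *)
Definition pairprod n (y : 'I_n -> L) : L :=
  \prod_(i < n) \prod_(j < n | (i < j)%N) ((y i - y j + kap) / (y i - y j)).

Definition crossprod k l (x : 'I_k -> L) (z : 'I_l -> L) : L :=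
  \prod_(i < k) \prod_(j < l) ((x i - z j + kap) / (x i - z j)).

Lemma pairprod_split k l (y : 'I_(k + l) -> L) :
  pairprod y = pairprod (fun i => y (lshift l i)) * pairprod (fun j => y (rshift k j))
     * crossprod (fun i => y (lshift l i)) (fun j => y (rshift k j)).
Proof.
rewrite mulrAC /pairprod big_split_ord /=; congr (_ * _).
  rewrite -big_split; apply: eq_bigr => i _ /=.
  rewrite big_split_ord /=; congr (_ * _); apply: eq_bigl => j /=.
  by rewrite ltn_addr.
apply: eq_bigr => i _ /=; rewrite big_split_ord /= big_pred0 ?mul1r.
  by apply: eq_bigl => j /=; rewrite ltn_add2l.
by move=> j /=; rewrite ltnNge -ltnS ltnS ltnW // ltn_addr.
Qed.

Lemma pairprod_recl n (y : 'I_n.+1 -> L) :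
  pairprod y =
    \prod_(j < n)
      ((y ord0 - y (lift ord0 j) + kap) / (y ord0 - y (lift ord0 j)))
    * pairprod (fun j => y (lift ord0 j)).
Proof.
rewrite /pairprod big_ord_recl; congr (_ * _).
  by rewrite big_mkcond big_ord_recl /= mul1r.
by apply: eq_bigr => i _; rewrite big_mkcond big_ord_recl /= mul1r -big_mkcond.
Qed.

(* The pairs (i, j), i < j, are permuted by an adjacent transposition, except for
   the transposed one. *)
Lemma pairprod_adjperm n (y : 'I_n -> L) (i : 'I_n.-1) : injective y ->
  let a := kap / (y (ord_lo i) - y (ord_hi i)) in
  pairprod (fun j => y (adjperm i j)) * (1 + a) = pairprod y * (1 - a).
Proof.
move=> y_inj a; set lo := ord_lo i; set hi := ord_hi i.
have lohi : lo != hi := lo_neq_hi i.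
have pairE z : pairprod z = \prod_(p : 'I_n * 'I_n | (p.1 < p.2)%N)
    ((z p.1 - z p.2 + kap) / (z p.1 - z p.2)) by rewrite /pairprod pair_big_dep.
have sK : involutive (adjperm i) by move=> x; apply: tpermK.
pose f (p : 'I_n * 'I_n) := (adjperm i p.1, adjperm i p.2).
have fK : involutive f by case=> x z; rewrite /f /= !sK.
have ylohi : y lo - y hi != 0 by rewrite subr_eq0 inj_eq.
have yhilo : y hi - y lo != 0 by rewrite -opprB oppr_eq0.
rewrite !pairE (reindex_inj (inv_inj fK)) /=.
rewrite (bigD1 (hi, lo)) /=; last by rewrite adjperm_hi adjperm_lo /=.
rewrite [in RHS](bigD1 (lo, hi)) //= !sK.
have -> : \prod_(p : 'I_n * 'I_n |
      (adjperm i p.1 < adjperm i p.2)%N && (p != (hi, lo)))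
      ((y (adjperm i (adjperm i p.1)) - y (adjperm i (adjperm i p.2)) + kap) /
       (y (adjperm i (adjperm i p.1)) - y (adjperm i (adjperm i p.2))))
    = \prod_(p : 'I_n * 'I_n | (p.1 < p.2)%N && (p != (lo, hi)))
      ((y p.1 - y p.2 + kap) / (y p.1 - y p.2)).
  apply: eq_big => [[x z]|[x z] _] /=; last by rewrite !sK.
  rewrite !xpair_eqE /adjperm -/lo -/hi.
  have val_lo : lo = i :> nat by [].
  have val_hi : hi = i.+1 :> nat by [].
  by case: tpermP => [->|->|/eqP x_lo /eqP x_hi];
    case: tpermP => [->|->|/eqP z_lo /eqP z_hi];
    try move: x_lo x_hi; try move: z_lo z_hi;
    rewrite -?val_eqE /= ?val_lo ?val_hi; lia.
rewrite /a; move: (\prod_(p : 'I_n * 'I_n | _) _) ylohi yhilo; rewrite -/lo -/hi.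
move: (y lo) (y hi) => u v r uv vu.
by field; rewrite uv vu.
Qed.

(** Interpolate prod_j (X - y_j + kap) - prod_j (X - y_j) at the n+1 points y_a. Its coefficient of
    X^n is (n+1) kap by Viete, and kap times the left-hand side by Lagrange. *)
Lemma sum_lagrange n (y : 'I_n.+1 -> L) : injective y -> kap != 0 ->
  \sum_(a < n.+1) \prod_(j < n) ((y a - y (lift a j) + kap) / (y a - y (lift a j)))
  = n.+1%:R.
Proof.
move=> y_inj kap0.
pose den a := \prod_(j < n) (y a - y (lift a j)).
pose num a := \prod_(j < n) (y a - y (lift a j) + kap).
have den0 a : den a != 0.
  by apply/prodf_neq0 => j _; rewrite subr_eq0 inj_eq // neq_lift.
pose p := \prod_(j < n.+1) ('X - (y j - kap)%:P) - \prod_(j < n.+1) ('X - (y j)%:P).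
pose ell (a : 'I_n.+1) := \prod_(j < n) ('X - (y (lift a j))%:P).
have ell_monic a : ell a \is monic by apply: monic_prod_XsubC.
have size_ell a : size (ell a) = n.+1.
  by rewrite /ell size_prod_XsubC /index_enum -enumT size_enum_ord.
(* The Lagrange interpolant: [ell a] takes the value [den a] at y_a and vanishes at the other
   nodes. *)
pose q := \sum_a (kap * num a / den a) *: ell a.
have root_q b : q.[y b] = kap * num b.
  rewrite horner_sum (bigD1_ord b) //= hornerZ horner_prod.
  rewrite [X in _ + X]big1 => [|c _].
    rewrite addr0 (eq_bigr (fun j => y b - y (lift b j))) => [|j _].
      by rewrite divfK.
    by rewrite hornerXsubC.
  have := neq_lift b c; rewrite eq_sym => /unlift_some[j eq_b _].
  rewrite hornerZ horner_prod (bigD1 j) //= hornerXsubC -eq_b.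
  by rewrite subrr mul0r mulr0.
have root_p b : p.[y b] = kap * num b.
  rewrite hornerD hornerN !horner_prod !(bigD1_ord b) //= !hornerXsubC subrr mul0r subr0.
  rewrite opprB addrC addrNK; congr (_ * _); apply: eq_bigr => j _.
  by rewrite hornerXsubC opprB addrA addrAC.
have size_q : (size q <= n.+1)%N.
  rewrite (leq_trans (size_sum _ _ _)) //; apply/bigmax_leqP => a _.
  by rewrite (leq_trans (size_scale_leq _ _)) ?size_ell.
have index_n : size (index_enum 'I_n.+1) = n.+1.
  by rewrite /index_enum -enumT size_enum_ord.
have size_p : (size p <= n.+1)%N.
  (* Both products are monic of degree n+1, so their leading terms cancel. *)
  apply/leq_sizeP => j; rewrite leq_eqVlt => /predU1P[<-|lt_nj]; rewrite coefB.
    have lead r : (\prod_(j < n.+1) ('X - (r j)%:P))`_n.+1 = 1 :> L.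
      have /monicP := monic_prod_XsubC (index_enum 'I_n.+1) xpredT r.
      by rewrite /lead_coef size_prod_XsubC index_n.
    by rewrite !lead subrr.
  by rewrite !nth_default ?subrr // size_prod_XsubC index_n.
have eq_pq : p = q.
  apply/eqP; rewrite -subr_eq0; apply/eqP.
  apply: (@roots_geq_poly_eq0 _ _ (codom y)).
  - by apply/allP => _ /codomP[b ->]; rewrite rootE hornerD hornerN root_p root_q subrr.
  - by rewrite (map_inj_uniq y_inj) enum_uniq.
  rewrite size_codom card_ord.
  by rewrite (leq_trans (size_polyD _ _)) // geq_max size_p size_polyN size_q.
have coef_p : p`_n = kap * n.+1%:R.
  rewrite coefB; have subl r : (\prod_(j < n.+1) ('X - (r j)%:P))`_n = - \sum_j r j :> L.
    have := @coefPn_prod_XsubC L [seq r j | j <- index_enum 'I_n.+1].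
    by rewrite size_map index_n !big_map; apply.
  rewrite !subl opprK addrC -sumrB (eq_bigr (fun=> kap)) => [|j _].
    by rewrite sumr_const card_ord mulr_natr.
  by rewrite opprB addrC addrNK.
have coef_q : q`_n = kap * \sum_a num a / den a.
  rewrite coef_sum mulr_sumr; apply: eq_bigr => a _.
  have := ell_monic a; rewrite monicE lead_coefE size_ell /= => /eqP ell1.
  by rewrite coefZ ell1 mulr1 mulrA.
rewrite -[RHS](mulKf kap0) -coef_p eq_pq coef_q mulKf //.
by apply: eq_bigr => a _; rewrite prodf_div.
Qed.

(** Induction, splitting a permutation into the image a of 0 and a permutation of the rest. The
    factors involving position 0 depend on a only and sum to n+1 by [sum_lagrange]; the others sum
    to n!. *)
Lemma sum_pairprod n (y : 'I_n -> L) : injective y -> kap != 0 ->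
  \sum_(w : 'S_n) pairprod (fun j => y (w j)) = n`!%:R.
Proof.
move=> + kap0; elim: n y => [|n IHn] y y_inj.
  rewrite (eq_bigr (fun=> 1)) => [|w _]; last by rewrite /pairprod big_ord0.
  by rewrite sumr_const card_Sn.
pose f (p : 'I_n.+1 * 'S_n) := lift_perm ord0 p.1 p.2.
have f_inj : injective f.
  move=> [a s] [b t] /permP eq_st.
  have := eq_st ord0; rewrite !lift_perm_id /= => eq_ab; subst b; congr (_, _).
  by apply/permP=> j; have := eq_st (lift ord0 j); rewrite !lift_perm_lift => /lift_inj.
have f_bij : bijective f.
  by apply: inj_card_bij => //; rewrite card_prod card_ord !card_Sn.
rewrite (reindex f) /=; last exact: onW_bij.
rewrite -(pair_bigA _ (fun a s => pairprod (fun j => y (lift_perm ord0 a s j)))) /=.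
transitivity (\sum_a n`!%:R *
    \prod_(j < n) ((y a - y (lift a j) + kap) / (y a - y (lift a j)))).
  apply: eq_bigr => a _; rewrite -(IHn (fun j => y (lift a j))); last first.
    by move=> j j' /y_inj /lift_inj.
  rewrite mulr_suml; apply: eq_bigr => s _; rewrite pairprod_recl mulrC; congr (_ * _).
    by apply: eq_bigr => j _; apply: eq_bigr => j' _; rewrite !lift_perm_lift.
  rewrite [RHS](reindex_inj (@perm_inj _ s)); apply: eq_bigr => j _.
  by rewrite lift_perm_id lift_perm_lift.
by rewrite -mulr_sumr sum_lagrange // -natrM mulnC.
Qed.

End PairProduct.

(** * The Young subgroup S_k x S_l and averaging over it *)

Section Blocks.
Variables k l : nat.

Definition block_fun (u : 'S_k) (v : 'S_l) (x : 'I_(k + l)) : 'I_(k + l) :=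
  match split x with inl i => lshift l (u i) | inr j => rshift k (v j) end.

Lemma block_fun_inj u v : injective (block_fun u v).
Proof.
move=> x z; rewrite /block_fun -{2}(splitK x) -{2}(splitK z).
by case: (split x) (split z) => [i|j] [i'|j'] /=
  => [/lshift_inj/perm_inj->|/eqP|/eqP|/rshift_inj/perm_inj->] //;
  rewrite ?eq_lrshift ?eq_rlshift.
Qed.

Definition block_perm u v : 'S_(k + l) := perm (@block_fun_inj u v).

Lemma block_perm_l u v i : block_perm u v (lshift l i) = lshift l (u i).
Proof. by rewrite permE /block_fun (unsplitK (inl i)). Qed.

Lemma block_perm_r u v j : block_perm u v (rshift k j) = rshift k (v j).
Proof. by rewrite permE /block_fun (unsplitK (inr j)). Qed.

(** Left translation by the Young subgroup fixes F and the cross factor, while the two block factors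
    of the weight sum to k! and l!. *)
Lemma sum_block (L : fieldType) (kap : L) (y : 'I_(k + l) -> L) (F : 'S_(k + l) -> L) :
  injective y -> kap != 0 -> k`!%:R != 0 :> L -> l`!%:R != 0 :> L ->
  (forall u v w, F (block_perm u v * w)%g = F w) ->
  \sum_(w : 'S_(k + l)) pairprod kap (fun i => y (w i)) * F w
  = \sum_(w : 'S_(k + l))
      crossprod kap (fun i => y (w (lshift l i))) (fun j => y (w (rshift k j))) * F w.
Proof.
move=> y_inj kap0 k0 l0 F_block.
pose cross (w : 'S_(k + l)) :=
  crossprod kap (fun i => y (w (lshift l i))) (fun j => y (w (rshift k j))).
pose ppl (w : 'S_(k + l)) := pairprod kap (fun i => y (w (lshift l i))).
pose ppr (w : 'S_(k + l)) := pairprod kap (fun i => y (w (rshift k i))).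
have cross_block u v w : cross (block_perm u v * w)%g = cross w.
  rewrite /cross /crossprod [RHS](reindex_inj (@perm_inj _ u)).
  apply: eq_bigr => i _; rewrite [RHS](reindex_inj (@perm_inj _ v)).
  by apply: eq_bigr => j _; rewrite !permM block_perm_l block_perm_r.
have sum_pp w : \sum_u \sum_v ppl (block_perm u v * w)%g * ppr (block_perm u v * w)%g
    = k`!%:R * l`!%:R.
  have yw_inj (m : nat) (r : 'I_m -> 'I_(k + l)) :
      injective r -> injective (fun i => y (w (r i))).
    by move=> r_inj i j /y_inj /perm_inj /r_inj.
  rewrite -(sum_pairprod (yw_inj _ _ (@lshift_inj _ _)) kap0).
  rewrite -(sum_pairprod (yw_inj _ _ (@rshift_inj _ _)) kap0).
  rewrite big_distrlr /=; apply: eq_bigr => u _; apply: eq_bigr => v _.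
  by congr (_ * _); apply: eq_bigr => i _; apply: eq_bigr => j _;
    rewrite !permM ?block_perm_l ?block_perm_r.
(* Multiplying by k! l! replaces the average by a sum over the Young subgroup. *)
apply: (mulIf (mulf_neq0 k0 l0)); rewrite [RHS]mulr_suml.
transitivity (\sum_(u : 'S_k) \sum_(v : 'S_l)
    \sum_(w : 'S_(k + l)) pairprod kap (fun i => y (w i)) * F w).
  by rewrite !sumr_const !card_Sn -natrM mulr_natr mulnC mulrnA.
transitivity (\sum_(w : 'S_(k + l)) \sum_(u : 'S_k) \sum_(v : 'S_l) cross w * F w *
    (ppl (block_perm u v * w)%g * ppr (block_perm u v * w)%g)); last first.
  apply: eq_bigr => w _; rewrite -(sum_pp w) mulr_sumr.
  by apply: eq_bigr => u _; rewrite mulr_sumr.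
rewrite [RHS]exchange_big; apply: eq_bigr => u _.
rewrite [RHS]exchange_big; apply: eq_bigr => v _.
rewrite (reindex_inj (mulgI (block_perm u v))); apply: eq_bigr => w _ /=.
rewrite pairprod_split F_block -/(cross _) cross_block.
by rewrite [RHS]mulrC !mulrA.
Qed.

End Blocks.

(** * Comparison of the two products *)

Section Generic.
Variables (A : idomainType) (kappa : A).
Hypothesis kappa0 : kappa != 0.
Hypothesis fact_unit : forall n, (n`!%:R : A) \is a GRing.unit.

Local Notation iota n := (@tofrac {mpoly A[n]} \o @mpolyC n A).
Local Notation pt n := (fun i : 'I_n => tofrac ('X_i : {mpoly A[n]})).

Lemma mmap_generic n (p : {mpoly A[n]}) (w : 'S_n) :
  mmap (iota n) (fun i => pt n (w i)) p = tofrac (msym w p).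
Proof.
elim/mpoly_indX: p => [c|p q IHp IHq|i p IHp].
- by rewrite /msym !mmapC.
- by rewrite mmapD IHp IHq !rmorphD.
by rewrite !rmorphM /= IHp /msym !mmapX !mmap1U.
Qed.

Lemma pt_inj n : injective (pt n).
Proof.
move=> i j /eqP; rewrite tofrac_eq => /eqP /(congr1 (mcoeff U_(j))).
rewrite !mcoeffXU eqxx; case: eqVneq => // _ /eqP.
by rewrite eq_sym oner_eq0.
Qed.

(** This genericity makes the factors 1 - a_i nonzero at the point of coordinates X_i. *)
Lemma pt_diff n i j : pt n i - pt n j != iota n kappa.
Proof.
rewrite -rmorphB /= tofrac_eq; have [->|neq_ij] := eqVneq i j.
  by rewrite subrr eq_sym mpolyC_eq0.
apply/eqP => /(congr1 (mcoeff U_(i))) /eqP.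
rewrite mcoeffB !mcoeffXU eqxx [j == i]eq_sym (negbTE neq_ij) subr0.
by rewrite mcoeffC mnm1_eq0 mulr0 oner_eq0.
Qed.

Lemma iota_kappa n : iota n kappa != 0.
Proof. by rewrite /= tofrac_eq0 mpolyC_eq0. Qed.

Lemma iota_fact n m : iota n m`!%:R = m`!%:R.
Proof. by rewrite rmorph_nat. Qed.

Lemma fact_neq0 n m : m`!%:R != 0 :> {fraction {mpoly A[n]}}.
Proof.
rewrite -iota_fact /= tofrac_eq0 mpolyC_eq0.
by apply: contraTneq (fact_unit m) => ->; rewrite unitr0.
Qed.

(** * Action of the symmetrizer at the generic point *)

Section Degree.
Variable n : nat.
Local Notation L := {fraction {mpoly A[n]}}.
Local Notation M := {ffun 'S_n -> L}.
Local Notation acts := (daha_act (kappa := kappa) (iota n) (pt n)).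
Local Notation e := (symmetrizer kappa n).
Local Notation Y := (@dY A kappa n).
Let ptI := @pt_inj n.
Local Notation weight w := (pairprod (iota n kappa) (fun i => pt n (w i))).

Lemma sum_weight_demazure i (F : M) :
  \sum_(w : 'S_n) weight w * demazure kappa (iota n) (pt n) i F w
  = \sum_(w : 'S_n) weight w * F w.
Proof.
pose a (w : 'S_n) := iota n kappa / (pt n (w (ord_lo i)) - pt n (w (ord_hi i))).
have a_adj w : a (adjperm i * w)%g = - a w.
  by rewrite /a !permM adjperm_lo adjperm_hi -mulrN -invrN opprB.
have weight_adj (w : 'S_n) :
    weight (adjperm i * w)%g * (1 + a w) = weight w * (1 - a w).
  have yw_inj : injective (fun j => pt n (w j)) by move=> x z /pt_inj /perm_inj.
  rewrite -(pairprod_adjperm (iota n kappa) i yw_inj); congr (_ * _).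
  by apply: eq_bigr => x _; apply: eq_bigr => z _; rewrite !permM.
(* Write the operator as a F + (1 - a) s_i F and translate the second sum by s_i, which turns a into
   -a; [weight_adj] then makes the coefficients add up to the weight. *)
transitivity (\sum_(w : 'S_n) weight w * (a w * F w)
    + \sum_(w : 'S_n) weight w * ((1 - a w) * F (adjperm i * w)%g)).
  rewrite -big_split; apply: eq_bigr => w _; rewrite /= ffunE -/(a w) -mulrDr.
  by congr (_ * _); ring.
rewrite [X in _ + X](reindex_inj (mulgI (adjperm i))) -big_split.
apply: eq_bigr => w _; rewrite /= adjpermK a_adj opprK [X in _ + X]mulrA weight_adj; ring.
Qed.

Lemma sum_weight : \sum_(w : 'S_n) weight w = n`!%:R.
Proof. exact: (sum_pairprod (@pt_inj n) (iota_kappa n)). Qed.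

Lemma sum_weight_act_symmetrizer (F : M) :
  \sum_(w : 'S_n) weight w * acts e F w = \sum_(w : 'S_n) weight w * F w.
Proof.
have act_dperm (v : 'S_n) G : \sum_(w : 'S_n) weight w * acts (dperm kappa v) G w
    = \sum_(w : 'S_n) weight w * G w.
  rewrite /dperm; elim: (perm_word v) G => [|i t IHt] G.
    by rewrite big_nil (daha_act1 _ _ ptI).
  by rewrite big_cons (daha_actM _ ptI) (daha_act_sigma _ _ ptI) sum_weight_demazure IHt.
pose S x := \sum_(w : 'S_n) weight w * acts x F w.
have S0 : S 0 = 0 by apply: big1 => w _; rewrite (daha_act0 _ _ ptI) ffunE mulr0.
have SD : {morph S : x z / x + z}.
  by move=> x z; rewrite -big_split; apply: eq_bigr => w _;
    rewrite /= (daha_actD _ ptI) ffunE mulrDr.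
have act_sum : S (\sum_(v : 'S_n) dperm kappa v)
    = n`!%:R * \sum_(w : 'S_n) weight w * F w.
  rewrite (big_morph S SD S0) (eq_bigr _ (fun v _ => act_dperm v F)).
  by rewrite sumr_const card_Sn mulr_natl.
rewrite /symmetrizer; under eq_bigr do rewrite (daha_actZ _ ptI) ffunE mulrCA.
rewrite -mulr_sumr -/(S _) act_sum mulrA -(iota_fact n) -rmorphM.
by rewrite mulVr // rmorph1 mul1r.
Qed.

Lemma act_symmetrizer (F : M) : acts e F
  = [ffun=> (n`!%:R)^-1 * \sum_(w : 'S_n) weight w * F w].
Proof.
have [c eq_c] := daha_act_symmetrizer_cst ptI F (@pt_diff n).
rewrite -sum_weight_act_symmetrizer eq_c; apply/ffunP=> w; rewrite !ffunE.
under eq_bigr do rewrite ffunE.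
by rewrite -mulr_suml sum_weight mulKf // fact_neq0.
Qed.

Lemma act_symmetrizer1 : acts e [ffun=> 1] = [ffun=> 1].
Proof.
rewrite act_symmetrizer; apply/ffunP=> w; rewrite !ffunE.
under eq_bigr do rewrite ffunE mulr1.
by rewrite sum_weight mulVf // fact_neq0.
Qed.

(** Since [e] fixes the constant function 1, both sides send it to the values of p and q on the
    orbit, and the value at the generic point itself determines a polynomial. *)
Lemma peval_symmetrizer_inj p q :
  peval p Y * e = peval q Y * e -> p = q.
Proof.
move=> /(congr1 (fun x => acts x [ffun=> 1] 1%g)).
rewrite !(daha_actM _ ptI) !act_symmetrizer1 !(daha_act_peval _ _ ptI).
rewrite !ffunE !mulr1 !mmap_generic !msym1m /=.
by move/eqP; rewrite tofrac_eq => /eqP.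
Qed.

Lemma sum_weight_cst c : (n`!%:R)^-1 * (\sum_(w : 'S_n) weight w * c) = c.
Proof. by rewrite -mulr_suml sum_weight mulKf // fact_neq0. Qed.

Lemma symmetrizer_peval_sym p : exists h : sympoly A n,
  e * (peval p Y * e) = peval h Y * e /\
  tofrac (sympoly_val h) = (n`!%:R)^-1 *
    \sum_(w : 'S_n) weight w * mmap (iota n) (fun i => pt n (w i)) p.
Proof.
have [q eq_q] := symmetrizer_peval kappa p.
(* The right-hand side does not involve the outer [w], because [e] yields constant functions; hence
   q is symmetric. *)
have acts_q w : tofrac (msym w q) = (n`!%:R)^-1 *
    \sum_(w : 'S_n) weight w * mmap (iota n) (fun i => pt n (w i)) p.
  have := congr1 (fun x => acts x [ffun=> 1] w) eq_q.
  rewrite !(daha_actM _ ptI) !(daha_act_peval _ _ ptI) act_symmetrizer1.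
  rewrite act_symmetrizer !ffunE mulr1 mmap_generic => <-; congr (_ * _).
  by apply: eq_bigr => v _; rewrite !ffunE mulr1.
have sym_q : q \is symmetric.
  apply/issymP => w; apply/eqP; rewrite -tofrac_eq acts_q -(acts_q 1%g) msym1m.
  exact: eqxx.
by exists (SymPoly sym_q); split; rewrite //= -(acts_q 1%g) msym1m.
Qed.

(** A symmetric polynomial takes one value on the whole orbit, so its weighted average is itself. *)
Lemma spherical_sympoly (h : sympoly A n) : spherical kappa h = peval h Y * e.
Proof.
have [q [eq_q frac_q]] := symmetrizer_peval_sym h.
rewrite /spherical -mulrA eq_q; suff -> : sympoly_val q = h by [].
apply/eqP; rewrite -tofrac_eq frac_q -[X in _ == X]sum_weight_cst; apply/eqP.
congr (_ * _); apply: eq_bigr => w _.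
by rewrite mmap_generic (issymP _ (sympolyP h)).
Qed.

Lemma spherical_inj (h h' : sympoly A n) :
  spherical kappa h = spherical kappa h' -> h = h'.
Proof. by rewrite !spherical_sympoly => /peval_symmetrizer_inj /val_inj. Qed.

End Degree.

Lemma eq_mmap m (T S : nzRingType) (phi : T -> S) (h h' : 'I_m -> S) p :
  h =1 h' -> mmap phi h p = mmap phi h' p.
Proof. by move=> eq_h; apply: eq_bigr => i _; rewrite (mmap1_eq _ eq_h). Qed.

Lemma symmetric_mmap m (S : comNzRingType) (phi : {rmorphism A -> S})
    (h : 'I_m -> S) (u : 'S_m) p : p \is symmetric ->
  mmap phi (fun i => h (u i)) p = mmap phi h p.
Proof.
move=> /issymP sym_p; rewrite -[in RHS](sym_p u) mmap_rename //.
- by move=> i j; apply: mulrC.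
- by move=> a x; apply: mulrC.
Qed.

(** A single witness for both defining conditions shows that neither [xget] falls back to its
    default and, by uniqueness, that the two products agree. *)
Lemma hecke_shuffle k l (f : sympoly A k) (g : sympoly A l) :
  exists h : sympoly A (k + l), spherical kappa h = hecke_elt kappa f g /\
    tofrac (sympoly_val h) = shuffle_elt kappa f g.
Proof.
pose f' : {mpoly A[k + l]} := mmap (@mpolyC _ A) (fun i => 'X_(lshift l i)) f.
pose g' : {mpoly A[k + l]} := mmap (@mpolyC _ A) (fun j => 'X_(rshift k j)) g.
have [h [eq_h frac_h]] := symmetrizer_peval_sym (f' * g').
exists h; split.
  by rewrite spherical_sympoly -eq_h pevalM !peval_rename /hecke_elt !mulrA.
rewrite frac_h /shuffle_elt /symmetrize; congr (_ * _).
pose F (w : 'S_(k + l)) := mmap (iota (k + l)) (fun i => pt (k + l) (w i)) (f' * g').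
have mmap_f (y : 'I_(k + l) -> {fraction {mpoly A[k + l]}}) :
    mmap (iota (k + l)) y (f' * g') =
    mmap (iota (k + l)) (fun i => y (lshift l i)) f *
    mmap (iota (k + l)) (fun j => y (rshift k j)) g.
  by rewrite rmorphM /= !mmap_rename // => *; apply: mulrC.
(* The symmetry of f and g makes F invariant under the Young subgroup, and the remaining cross
   factor is the shuffle kernel. *)
rewrite -/(F _) (sum_block (F := F) (@pt_inj _) (iota_kappa _)) ?fact_neq0 //.
  by apply: eq_bigr => w _; rewrite /F mmap_f mulrA.
move=> u v w; rewrite /F !mmap_f.
rewrite (eq_mmap _ f (h' := fun i => pt (k + l) (w (lshift l (u i))))); last first.
  by move=> i; rewrite permM block_perm_l.
rewrite (eq_mmap _ g (h' := fun j => pt (k + l) (w (rshift k (v j))))); last first.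
  by move=> j; rewrite permM block_perm_r.
rewrite (symmetric_mmap _ (fun i => pt (k + l) (w (lshift l i))) u (sympolyP f)).
by rewrite (symmetric_mmap _ (fun j => pt (k + l) (w (rshift k j))) v (sympolyP g)).
Qed.

Lemma hecke_mulP k l (f : sympoly A k) (g : sympoly A l) :
  spherical kappa (hecke_mul kappa f g) = hecke_elt kappa f g.
Proof.
have [h [sph_h _]] := hecke_shuffle f g.
exact: (@xgetI (sympoly A (k + l)) 0
  (fun h => spherical kappa h = hecke_elt kappa f g) h sph_h).
Qed.

Lemma shuffle_mulP k l (f : sympoly A k) (g : sympoly A l) :
  tofrac (sympoly_val (shuffle_mul kappa f g)) = shuffle_elt kappa f g.
Proof.
have [h [_ frac_h]] := hecke_shuffle f g.
exact: (@xgetI (sympoly A (k + l)) 0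
  (fun h => tofrac (sympoly_val h) = shuffle_elt kappa f g) h frac_h).
Qed.

Lemma hecke_mul_shuffle_mul k l (f : sympoly A k) (g : sympoly A l) :
  hecke_mul kappa f g = shuffle_mul kappa f g.
Proof.
have [h [sph_h frac_h]] := hecke_shuffle f g.
transitivity h; first by apply: spherical_inj; rewrite hecke_mulP.
by apply/val_inj/eqP; rewrite /= -tofrac_eq shuffle_mulP frac_h.
Qed.

End Generic.

(** The second conjunct certifies that both products satisfy their defining equations, so the
    isomorphism does not compare default values. *)
Theorem theorem1 (R : realType) (kappa : {poly R[i]})
    (hkappa : kappa = 'X \/ kappa = - 'X) :
  graded_algebra_isomorphism (X := hecke_galg kappa) (Y := shuffle_galg kappa)
    (fun x => x)
  /\
  (forall (k l : nat) (f : sympoly {poly R[i]} k) (g : sympoly {poly R[i]} l),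
    [/\ spherical kappa (hecke_mul kappa f g) = hecke_elt kappa f g,
        tofrac (sympoly_val (shuffle_mul kappa f g)) = shuffle_elt kappa f g
      & hecke_mul kappa f g = shuffle_mul kappa f g]).
Proof.
have kappa0 : kappa != 0.
  by case: hkappa => ->; rewrite ?oppr_eq0 polyX_eq0.
have fact_unit n : (n`!%:R : {poly R[i]}) \is a GRing.unit.
  have fact_neq0 : (n`!%:R : R[i]) != 0 by rewrite Num.Theory.pnatr_eq0 -lt0n fact_gt0.
  by rewrite -(rmorph_nat (@polyC _)) poly_unitE coefC size_polyC fact_neq0 unitfE.
have mulE k l (f : sympoly _ k) (g : sympoly _ l) :
  hecke_mul kappa f g = shuffle_mul kappa f g
  := hecke_mul_shuffle_mul kappa0 fact_unit f g.
split=> [|k l f g]; last first.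
  by split; [exact: hecke_mulP|exact: shuffle_mulP|].
split=> //.
- by exists id.
- by move=> n u; exists u.
(* Both algebras have the same graded pieces, so the two double sums have equal bounds and only
   homogeneous products remain to be compared. *)
move=> x y; rewrite /dsum_mul; apply: eq_bigr => k _; apply: eq_bigr => l _.
by congr dsum_in; apply: mulE.
Qed.
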